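(* Let $X=(X_1,X_2)$ be a two-good random valuation with $X_1,X_2$ independent and each weakly regular. Then \[ \frac{\textsc{SRev}(X_1,X_2)}{\textsc{Rev}(X_1,X_2)}\;\geq\;\frac{e}{e+1}\approx 0.73 . \]
   Context: A one-dimensional random variable $X\ge 0$ is weakly regular if its support is an interval $[\alpha,\beta]$ with $0\le\alpha<\beta\le\infty$ (understood as $[\alpha,\infty)$ if $\beta=\infty$), on which it has a positive continuous density $f$, and the virtual valuation $t-G(t)/f(t)$ is nondecreasing on it, where $G(t)=\mathbb{P}[X\ge t]$. A $k$-good random valuation is a random vector $X$ in $\mathbb{R}_+^k$. A mechanism is a pair $\mu=(q,s)$ of Borel functions $q:\mathbb{R}_+^k\to[0,1]^k$, $s:\mathbb{R}_+^k\to\mathbb{R}$, with buyer payoff $b(x)=q(x)\cdot x-s(x)$; IR means $b(x)\ge0$ for all $x$; IC means $b(x)\ge q(\tilde x)\cdot x-s(\tilde x)$ for all $x,\tilde x$. $R(\mu;X)=\mathbb{E}[s(X)]$, $\textsc{Rev}(X)=\sup R(\mu;X)$ over IC and IR mechanisms, and $\textsc{SRev}(X)=\sum_i\textsc{Rev}(X_i)$. *)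

(* Defs.v *)
From HB Require Import structures.
From mathcomp Require Import all_boot all_order all_algebra.
From mathcomp Require Import all_classical all_reals all_analysis.
Set Implicit Arguments. Unset Strict Implicit. Unset Printing Implicit Defensive.
Import Order.TTheory GRing.Theory Num.Theory.
Import numFieldNormedType.Exports.
Local Open Scope classical_set_scope.
Local Open Scope ring_scope.

Section Defs.
Context {R : realType} {d : measure_display} {T : measurableType d}.

Definition indep2 (P : probability T R) (X1 X2 : T -> R) : Prop :=
  forall A B : set R, measurable A -> measurable B ->
    P (X1 @^-1` A `&` X2 @^-1` B) = (P (X1 @^-1` A) * P (X2 @^-1` B))%E.

Definition tailG (P : probability T R) (X : T -> R) (t : R) : R :=
  fine (P (X @^-1` [set x | t <= x])).

Definition weakly_regular (P : probability T R) (X : T -> R) : Prop :=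
  measurable_fun setT X /\
  exists (alpha : R) (beta : \bar R) (f : R -> R),
    let I := [set t : R | alpha <= t /\ (t%:E <= beta)%E] in
    [/\ 0 <= alpha /\ (alpha%:E < beta)%E,
        (forall A : set R, measurable A ->
           P (X @^-1` A) = (\int[lebesgue_measure]_(t in (A `&` I)) (f t)%:E)%E),
        ({within I, continuous f}),
        (forall t, I t -> 0 < f t) &
        (forall t u, I t -> I u -> t <= u ->
           t - tailG P X t / f t <= u - tailG P X u / f u)].

Definition mech1 (q s : R -> R) : Prop :=
  [/\ measurable_fun setT q, measurable_fun setT s,
      (forall x, 0 <= q x <= 1),
      (forall x, 0 <= x -> 0 <= q x * x - s x) &
      (forall x x', 0 <= x -> 0 <= x' -> q x' * x - s x' <= q x * x - s x)].

Definition mech2 (q1 q2 s : R * R -> R) : Prop :=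
  let b := fun (y x : R * R) => q1 y * x.1 + q2 y * x.2 - s y in
  [/\ [/\ measurable_fun setT q1, measurable_fun setT q2 & measurable_fun setT s],
      (forall x, 0 <= q1 x <= 1 /\ 0 <= q2 x <= 1),
      (forall x, 0 <= x.1 -> 0 <= x.2 -> 0 <= b x x) &
      (forall x x', 0 <= x.1 -> 0 <= x.2 -> 0 <= x'.1 -> 0 <= x'.2 ->
         b x' x <= b x x)].

Definition Rev1 (P : probability T R) (X : T -> R) : \bar R :=
  ereal_sup [set (\int[P]_w (s (X w))%:E)%E | s in
              [set s | exists q, mech1 q s]].

Definition Rev2 (P : probability T R) (X1 X2 : T -> R) : \bar R :=
  ereal_sup [set (\int[P]_w (s (X1 w, X2 w))%:E)%E | s in
              [set s | exists q1 q2, mech2 q1 q2 s]].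

Definition SRev2 (P : probability T R) (X1 X2 : T -> R) : \bar R :=
  (Rev1 P X1 + Rev1 P X2)%E.

End Defs.

(* Main.v *)
(* Let b be the buyer's payoff, q_i(t,t) the diagonal allocations, G_i the tail
   of X_i, r_i = Rev(X_i) and M_i(y) = E[min(X_i,y)].  For fixed X_2 = y, on
   {X_1 >= y} the payment s - y q_2 is, up to the amount charged to type (y,y),
   (1 - q_1(y,y)) times a one-good mechanism for X_1; also q_2(x,y) <= q_2(x,x)
   there.  Summing over the two sides of the diagonal, with Z = min(X_1,X_2),
     E s <= r_1 + r_2 + E[q_1(X_2,X_2) (M_1(X_2) - r_1)]
                      + E[q_2(X_1,X_1) (M_2(X_1) - r_2)] - E b(Z,Z),
   and E b(Z,Z) >= int (q_1+q_2)(t,t) G_1 G_2 dt because t |-> b(t,t) has the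
   subgradient q_1 + q_2.  Hence the surplus over r_1 + r_2 is at most the sum of
     int q_2(t,t) c(t) dt,   c = f_1 (M_2 - r_2) - G_1 G_2,
   and its mirror image.  Regularity of X_1 says that G_1/f_1 grows at rate at
   most 1, while (M_2 - r_2)/G_2 grows at rate at least 1, so c changes sign
   once, at some m, and the integral is at most
     int_m^oo c = G_1(m) (M_2(m) - r_2) <= (r_1/m) (m/e) = r_1/e. *)
Require Import Defs.
From HB Require Import structures.
From mathcomp Require Import all_boot all_order all_algebra.
From mathcomp Require Import all_classical all_reals all_analysis.
From mathcomp Require Import measurable_realfun ring lra.
Import Order.TTheory GRing.Theory Num.Theory.
Import numFieldNormedType.Exports.
Local Open Scope classical_set_scope.
Local Open Scope ring_scope.

(** * Tails and truncated means of laws on the line *)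

Section laws_on_the_line.
Set Implicit Arguments. Unset Strict Implicit. Unset Printing Implicit Defensive.
Context {R : realType}.
Local Notation lam := (@lebesgue_measure R).
Implicit Types mu nu : probability (measurableTypeR R) R.

Definition tail mu (u : R) : R := fine (mu `[u, +oo[%classic).

Lemma EFin_tail mu u : (tail mu u)%:E = mu `[u, +oo[%classic.
Proof. by rewrite fineK// fin_num_measure. Qed.

(** The inner integral over [[0, x]] as a function on the plane, so that Tonelli can exchange the
    order of integration. *)
Let below (g : R -> \bar R) (z : R * R) : \bar R :=
  if (0 <= z.2) && (z.2 <= z.1) then g z.2 else 0%E.

Let measurable_below (g : R -> \bar R) :
  measurable_fun setT g -> measurable_fun setT (below g).
Proof.
move=> mg; apply: measurable_fun_ifT => //=; last exact: (measurableT_comp mg).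
by apply: measurable_and; apply: measurable_fun_ler.
Qed.

Let below_ge0 (g : R -> \bar R) z : (forall u, 0 <= g u)%E -> (0 <= below g z)%E.
Proof. by move=> g0; rewrite /below; case: ifP. Qed.

Let integral_below (g : R -> \bar R) (x : R) :
  (\int[lam]_(u in `[0%R, x]) g u = \int[lam]_u below g (x, u))%E.
Proof.
rewrite integral_mkcond; apply: eq_integral => u _.
by rewrite patchE /below mem_setE in_itv.
Qed.

Lemma measurable_integral_itv0 (g : R -> \bar R) :
  measurable_fun setT g -> (forall u, 0 <= g u)%E ->
  measurable_fun setT (fun x : R => \int[lam]_(u in `[0%R, x]) g u)%E.
Proof.
move=> mg g0; under eq_fun do rewrite integral_below.
apply: measurable_fun_fubini_tonelli_F; first exact: measurable_below.
by move=> z; exact: below_ge0.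
Qed.

(** Tonelli on the region [0 <= u <= x]: for fixed [u] the section in [x] is the ray from [u], of
    mass [tail mu u]. A negative [x] gives an empty inner interval. *)
Lemma layer_cake mu (g : R -> \bar R) :
  measurable_fun setT g -> (forall u, 0 <= g u)%E ->
  (\int[mu]_x \int[lam]_(u in `[0%R, x]) g u =
   \int[lam]_(u in `[0%R, +oo[) (g u * (tail mu u)%:E))%E.
Proof.
move=> mg g0; have mF := measurable_below mg; have F0 z := below_ge0 z g0.
under eq_integral do rewrite integral_below.
rewrite fubini_tonelli// [RHS]integral_mkcond; apply: eq_integral => u _.
rewrite patchE mem_setE in_itv/= andbT /below/=; case: ifPn => u0 /=; last first.
  by apply: integral0_eq => x _; rewrite ?(negbTE u0).
transitivity (\int[mu]_(x in `[u, +oo[) cst (g u) x)%E.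
  rewrite [RHS]integral_mkcond; apply: eq_integral => x _.
  by rewrite patchE mem_setE in_itv/= andbT.
by rewrite integral_cst//= EFin_tail.
Qed.

Lemma tail_ge0 mu u : 0 <= tail mu u.
Proof. by rewrite -lee_fin EFin_tail. Qed.

Lemma tail_le1 mu u : tail mu u <= 1.
Proof. by rewrite -lee_fin EFin_tail; exact: probability_le1. Qed.

Lemma tail_nincr mu u v : u <= v -> tail mu v <= tail mu u.
Proof.
move=> uv; rewrite -lee_fin !EFin_tail; apply: le_measure; rewrite ?inE//.
by apply: subset_itvr; rewrite bnd_simp.
Qed.

Lemma measurable_tail mu : measurable_fun setT (tail mu).
Proof.
by apply: nonincreasing_measurable => // u v uv; exact: tail_nincr.
Qed.

(* The expectation of [min X x] when the law of [X] is [mu] (see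
   [integral_min]). *)
Definition mean_min mu (x : R) : R :=
  fine (\int[lam]_(u in `[0%R, x]) (tail mu u)%:E).

Let intail_le mu (x y : R) : x <= y ->
  (\int[lam]_(u in `[x, y]) (tail mu u)%:E <= (y - x)%:E)%E.
Proof.
move=> xy; rewrite -[leRHS]mul1e -(_ : lam `[x, y] = (y - x)%:E)%E; last first.
  by rewrite lebesgue_measure_itv/= lte_fin; case: ltgtP xy => // ->; rewrite subrr.
rewrite -integral_cst//; apply: ge0_le_integral => //=.
- by move=> u _; rewrite lee_fin tail_ge0.
- by apply/measurable_EFinP; apply: measurable_funTS; exact: measurable_tail.
- by move=> u _; rewrite lee_fin tail_le1.
Qed.

Lemma EFin_mean_min mu x : (mean_min mu x)%:E = (\int[lam]_(u in `[0%R, x]) (tail mu u)%:E)%E.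
Proof.
rewrite fineK// ge0_fin_numE; last by apply: integral_ge0 => u _; rewrite lee_fin tail_ge0.
have [x0|x0] := leP 0 x; last by rewrite set_itv_ge ?bnd_simp -?ltNge// integral_set0.
exact: le_lt_trans (intail_le mu x0) (ltry _).
Qed.

Lemma mean_min_ge0 mu x : 0 <= mean_min mu x.
Proof.
by rewrite -lee_fin EFin_mean_min; apply: integral_ge0 => u _; rewrite lee_fin tail_ge0.
Qed.

Lemma mean_minD mu (x y : R) : 0 <= x -> x <= y ->
  ((mean_min mu y)%:E = (mean_min mu x)%:E + \int[lam]_(u in `[x, y]) (tail mu u)%:E)%E.
Proof.
move=> x0 xy; rewrite !EFin_mean_min.
have mt (A : set R) : measurable_fun A (fun u => (tail mu u)%:E).
  by apply/measurable_EFinP; apply: measurable_funTS; exact: measurable_tail.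
rewrite -(integral_itv_obnd_cbnd (mt _)) -ge0_integral_setU//=.
- by rewrite -itv_bndbnd_setU// bnd_simp.
- exact: mt.
- by move=> u _; rewrite lee_fin tail_ge0.
- by apply: lt_disjoint => u v; rewrite !in_itv/= => /andP[_ ux] /andP[xv _];
    exact: le_lt_trans xv.
Qed.

(** The tail, being nonincreasing, is at least [tail mu y] on [[x, y]]. This growth estimate drives
    the single crossing. *)
Lemma mean_min_incr_ge mu (x y : R) : 0 <= x -> x <= y ->
  mean_min mu x + (y - x) * tail mu y <= mean_min mu y.
Proof.
move=> x0 xy; rewrite -lee_fin (mean_minD mu x0 xy) EFinD leeD2l//.
rewrite mulrC EFinM -(_ : lam `[x, y] = (y - x)%:E)%E; last first.
  by rewrite lebesgue_measure_itv/= lte_fin; case: ltgtP xy => // ->; rewrite subrr.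
rewrite -integral_cst//; apply: ge0_le_integral => //=.
- by move=> u _; rewrite lee_fin tail_ge0.
- by apply/measurable_EFinP; apply: measurable_funTS; exact: measurable_tail.
- by move=> u; rewrite in_itv/= lee_fin => /andP[_]; exact: tail_nincr.
Qed.

Lemma mean_min_neg mu x : x < 0 -> mean_min mu x = 0.
Proof. by move=> x0; rewrite /mean_min set_itv_ge ?integral_set0// bnd_simp -ltNge. Qed.

Lemma mean_min_ndecr mu x y : x <= y -> mean_min mu x <= mean_min mu y.
Proof.
move=> xy; have [x0|x0] := leP 0 x; last by rewrite mean_min_neg// mean_min_ge0.
apply: le_trans (mean_min_incr_ge mu x0 xy).
by rewrite lerDl mulr_ge0// ?subr_ge0// tail_ge0.
Qed.

Lemma measurable_mean_min mu : measurable_fun setT (mean_min mu).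
Proof. by apply: nondecreasing_measurable => // u v uv; exact: mean_min_ndecr. Qed.

Lemma mean_min_le_id mu x : 0 <= x -> mean_min mu x <= x.
Proof. by move=> x0; rewrite -lee_fin EFin_mean_min (le_trans (intail_le mu x0))// subr0. Qed.

(** Truncation at 0 matches the empty integral in [mean_min], so that [integral_min] holds for laws
    and levels of any sign. *)
Definition pmin (x y : R) : R := Num.max 0 (Num.min x y).

(** The layer cake formula for the indicator of [[0, y]], whose integral over [[0, x]] is
    [pmin x y]. *)
Lemma integral_min mu y : (\int[mu]_x (pmin x y)%:E = (mean_min mu y)%:E)%E.
Proof.
pose g (u : R) := (\1_(`[0%R, y] : set R) u)%:E : \bar R.
have mg : measurable_fun setT g by apply/measurable_EFinP; exact: measurable_indic.
transitivity (\int[mu]_x \int[lam]_(u in `[0%R, x]) g u)%E.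
  apply: eq_integral => x _; rewrite integral_indic//= -set_itvI/= lebesgue_measure_itv/=.
  rewrite joinxx /pmin meetEtotal lte_fin/= sube0 /Num.max /Num.min/=.
  have -> : (if x < y then x else y) = (if y < x then y else x) by case: ltgtP.
  by case: ifP.
rewrite layer_cake//; last by move=> u; rewrite lee_fin.
rewrite EFin_mean_min [RHS]integral_mkcond [LHS]integral_mkcond; apply: eq_integral => u _.
rewrite !patchE /g indicE !mem_setE !in_itv/= andbT; case: (0 <= u) => //=.
by case: (u <= y); rewrite ?mul1e ?mul0e.
Qed.

End laws_on_the_line.

(** * Densities, and the logarithmic bound on truncated means *)

Section density.
Set Implicit Arguments. Unset Strict Implicit. Unset Printing Implicit Defensive.
Context {R : realType}.
Local Notation lam := (@lebesgue_measure R).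
Implicit Types mu nu : probability (measurableTypeR R) R.

(** Having the same integral over every measurable set, [phi] is almost everywhere the Radon-Nikodym
    derivative of [mu]; the change of variables formula then applies. *)
Lemma integral_density mu (phi : R -> R) :
  measurable_fun setT phi -> (forall t, 0 <= phi t) ->
  (forall A : set R, measurable A -> mu A = (\int[lam]_(t in A) (phi t)%:E)%E) ->
  forall h : R -> R, measurable_fun setT h -> (forall t, 0 <= h t) ->
  (\int[mu]_x (h x)%:E = \int[lam]_t (h t * phi t)%:E)%E.
Proof.
move=> mphi phi0 muE h mh h0.
have mphiE (A : set R) : measurable_fun A (EFin \o phi).
  by apply/measurable_EFinP; apply: measurable_funTS.
have dom : mu `<< lam.
  apply/null_content_dominatesP => A mA A0.
  by rewrite muE//; apply: null_set_integral => //; exact: mphiE.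
have phiI : lam.-integrable setT (EFin \o phi).
  apply/integrableP; split; first exact: mphiE.
  rewrite [ltLHS](_ : _ = \int[lam]_t (EFin \o phi) t)%E.
    by rewrite -muE//= probability_setT ltry.
  by apply: eq_integral => x _; rewrite gee0_abs ?lee_fin.
have aeE := @integral_ae_eq _ _ _ lam setT measurableT
  (Radon_Nikodym_SigmaFinite.f mu lam) (EFin \o phi) phiI.
rewrite -(Radon_Nikodym_SigmaFinite.change_of_variables dom)//; last first.
  exact/measurable_EFinP.
have mRN := measurable_int _ (Radon_Nikodym_SigmaFinite.f_integrable dom).
apply: ge0_ae_eq_integral => //.
- by apply: emeasurable_funM => //; exact/measurable_EFinP.
- by apply/measurable_EFinP; exact: measurable_funM.
- by move=> x _; rewrite mule_ge0 ?lee_fin// Radon_Nikodym_SigmaFinite.f_ge0.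
- by move=> x _; rewrite lee_fin mulr_ge0.
under [X in ae_eq _ _ _ X]eq_fun do rewrite EFinM.
apply: ae_eqe_mul2l; apply: ae_eq_sym; apply: aeE => // E _ mE.
by rewrite -muE// -Radon_Nikodym_SigmaFinite.f_integral.
Qed.

(** The inequality [1 + w <= expR w] at [w = ln z - 1]. It is the source of the constant [1/e]. *)
Lemma ln_le_expR1 (z : R) : 0 < z -> ln z <= z / expR 1.
Proof.
move=> z0; have := expR_ge1Dx (ln z - 1).
by rewrite expRD lnK ?posrE// expRN addrC subrK.
Qed.

Lemma within_continuous_inv (a b : R) : 0 < a ->
  {within `[a, b], continuous (@GRing.inv R)}.
Proof.
move=> a0; apply: continuous_in_subspaceT => x.
rewrite inE/= in_itv/= => /andP[/(lt_le_trans a0) x0 _].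
by apply: inv_continuous; rewrite gt_eqF.
Qed.

Lemma integral_inv (a b : R) : 0 < a -> a < b ->
  (\int[lam]_(u in `[a, b]) (u^-1)%:E = (ln b - ln a)%:E)%E.
Proof.
move=> a0 ab.
have pos x : x \in `]a, b[ -> 0 < x by rewrite in_itv/= => /andP[/(lt_trans a0)].
rewrite (@continuous_FTC2 _ _ (@ln R))//.
- exact: within_continuous_inv.
- split=> [x /pos x0||].
  + by apply: ex_derive; exact: is_derive1_ln.
  + by apply: cvg_at_right_filter; exact: continuous_ln.
  + by apply: cvg_at_left_filter; apply: continuous_ln; exact: lt_trans ab.
- by move=> x /pos x0; rewrite derive1E; apply: derive_val; exact: is_derive1_ln.
Qed.

(** Split at [r]. Below it the tail is at most 1 and contributes at most [r]; above it the tail is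
    at most [r / u] and contributes at most [r * ln (m / r)], hence at most [m / e]. *)
Lemma mean_min_le nu (r m : R) : 0 <= r -> (forall u, 0 <= u -> u * tail nu u <= r) ->
  0 <= m -> mean_min nu m <= r + m / expR 1.
Proof.
move=> r0 tr m0; apply/ler_addgt0Pr => eps eps0; rewrite addrAC.
(* The splitting point must be positive for the logarithm, whereas [r] may vanish. *)
set r1 := r + eps; have r1_gt0 : 0 < r1 by rewrite ltr_wpDl.
have {}tr u : 0 <= u -> u * tail nu u <= r1.
  by move=> /tr /le_trans -> //; rewrite lerDl ltW.
have [mr|rm] := leP m r1.
  by rewrite (le_trans (mean_min_le_id _ _))// (le_trans mr)// lerDl divr_ge0// expR_ge0.
rewrite -lee_fin (mean_minD nu (ltW r1_gt0) (ltW rm)) EFinD leeD//.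
  by rewrite lee_fin mean_min_le_id// ltW.
have minv : measurable_fun `[r1, m] (fun u : R => (u^-1)%:E).
  apply/measurable_EFinP; apply: subspace_continuous_measurable_fun => //.
  exact: within_continuous_inv.
have pos u : u \in `[r1, m] -> 0 < u by rewrite in_itv/= => /andP[/(lt_le_trans r1_gt0)].
apply: (@le_trans _ _ (\int[lam]_(u in `[r1, m]) (r1%:E * (u^-1)%:E))%E).
  apply: ge0_le_integral => //=.
  - by move=> u _; rewrite lee_fin tail_ge0.
  - by apply/measurable_EFinP; apply: measurable_funTS; exact: measurable_tail.
  - by apply: emeasurable_funM => //; exact: measurable_cst.
  - move=> u /pos u0; rewrite -EFinM lee_fin ler_pdivlMr// mulrC.
    by apply: tr; exact: ltW.
rewrite ge0_integralZl_EFin//.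
- rewrite integral_inv// -EFinM lee_fin -ln_div ?posrE//; last exact: lt_trans rm.
  rewrite -ler_pdivlMl// mulrA (mulrC r1^-1) ln_le_expR1// divr_gt0//.
  exact: lt_trans rm.
- by move=> u /pos u0; rewrite lee_fin invr_ge0 ltW.
- exact: ltW.
Qed.

End density.

(** * Comparison of weights, and the integral over a ray *)

Section regular.
Set Implicit Arguments. Unset Strict Implicit. Unset Printing Implicit Defensive.
Context {R : realType}.
Local Notation lam := (@lebesgue_measure R).
Implicit Types mu nu : probability (measurableTypeR R) R.

(** Integration of [(Q - w) * c <= 0], where [c = phi * (mean_min nu - r) - tail mu * tail nu].
    Every negative term has been moved to the other side, so that all integrands are nonnegative and
    infinite integrals are covered. *)
Lemma le_integral_weights mu nu (phi w Q : R -> R) (r : R) : 0 <= r ->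
  measurable_fun setT phi -> (forall t, 0 <= phi t) ->
  (forall A : set R, measurable A -> mu A = (\int[lam]_(t in A) (phi t)%:E)%E) ->
  (forall t, t < 0 -> phi t = 0) ->
  measurable_fun setT w -> (forall t, 0 <= w t) ->
  measurable_fun setT Q -> (forall t, 0 <= Q t) ->
  (forall t, 0 <= t ->
    (Q t - w t) * (phi t * (mean_min nu t - r) - tail mu t * tail nu t) <= 0) ->
  (\int[mu]_x (Q x * mean_min nu x)%:E
    + (\int[lam]_(u in `[0%R, +oo[) (w u * (tail mu u * tail nu u))%:E
       + r%:E * \int[mu]_x (w x)%:E)
   <= r%:E * \int[mu]_x (Q x)%:E
    + (\int[lam]_(u in `[0%R, +oo[) (Q u * (tail mu u * tail nu u))%:E
       + \int[mu]_x (w x * mean_min nu x)%:E))%E.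
Proof.
move=> r0 mphi phi0 muE phi_neg mw w0 mQ Q0 Qw.
(* Extended by zero to the negative half-line, where [phi] vanishes too, the product of tails can be
   compared with the other terms in one integral over the line. *)
pose gg (t : R) : R := if 0 <= t then tail mu t * tail nu t else 0.
have gg0 t : 0 <= gg t by rewrite /gg; case: ifP => // _; rewrite mulr_ge0 ?tail_ge0.
have mgg : measurable_fun setT gg.
  apply: measurable_fun_ifT => //; last first.
    by apply: measurable_funM; exact: measurable_tail.
  by apply: measurable_fun_ler.
have mg := measurable_mean_min nu.
have ggE (h : R -> R) : (\int[lam]_(u in `[0%R, +oo[) (h u * (tail mu u * tail nu u))%:E
    = \int[lam]_u (h u * gg u)%:E)%E.
  rewrite integral_mkcond; apply: eq_integral => u _.
  by rewrite patchE mem_setE in_itv/= andbT /gg; case: ifP => //; rewrite mulr0.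
have muI (h : R -> R) := integral_density mphi phi0 muE (h := h).
rewrite !ggE !muI//; try exact: measurable_funM; try by move=> t; rewrite mulr_ge0 ?mean_min_ge0.
have Z (h : R -> R) : measurable_fun setT h -> (forall t, 0 <= h t) ->
    (r%:E * \int[lam]_t (h t * phi t)%:E = \int[lam]_t (r * (h t * phi t))%:E)%E.
  move=> mh h0; rewrite -ge0_integralZl_EFin//.
  - by move=> t _; rewrite lee_fin mulr_ge0.
  - by apply/measurable_EFinP; exact: measurable_funM.
have D (h k : R -> R) : measurable_fun setT h -> (forall t, 0 <= h t) ->
    measurable_fun setT k -> (forall t, 0 <= k t) ->
    (\int[lam]_t (h t)%:E + \int[lam]_t (k t)%:E = \int[lam]_t (h t + k t)%:E)%E.
  move=> mh h0 mk k0; rewrite -ge0_integralD//.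
  - by move=> t _; rewrite lee_fin.
  - exact/measurable_EFinP.
  - by move=> t _; rewrite lee_fin.
  - exact/measurable_EFinP.
rewrite !Z// !D//;
  try (by move=> t; rewrite ?addr_ge0 ?mulr_ge0 ?mean_min_ge0 ?gg0//);
  try (by do ?[apply: measurable_funD | apply: measurable_funM]).
apply: ge0_le_integral => //.
- by move=> t _; rewrite lee_fin ?addr_ge0 ?mulr_ge0 ?mean_min_ge0 ?gg0//.
- by apply/measurable_EFinP; do ?[apply: measurable_funD | apply: measurable_funM].
- by apply/measurable_EFinP; do ?[apply: measurable_funD | apply: measurable_funM].
move=> t _; rewrite lee_fin; have [t0|t0] := leP 0 t; last first.
  by rewrite /gg (lt_geF t0) phi_neg// !(mulr0, mul0r, addr0).
by have := Qw _ t0; rewrite /gg t0; lra.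
Qed.

Lemma integral_mean_min mu nu :
  (\int[mu]_x (mean_min nu x)%:E
   = \int[lam]_(u in `[0%R, +oo[) (tail mu u * tail nu u)%:E)%E.
Proof.
rewrite -[RHS](_ : \int[lam]_(u in `[0%R, +oo[) ((tail nu u)%:E * (tail mu u)%:E) = _)%E.
  rewrite -layer_cake//.
  - by apply: eq_integral => x _; rewrite EFin_mean_min.
  - by apply/measurable_EFinP; exact: measurable_tail.
  - by move=> u; rewrite lee_fin tail_ge0.
by apply: eq_integral => u _; rewrite -EFinM mulrC.
Qed.

(** On the ray, [mean_min nu x] is [mean_min nu m] plus the integral of [tail nu] over [[m, x]], and
    the layer cake formula turns the latter into the product of tails. The flag [b] makes the ray
    closed or open, as the set where [c] is positive may or may not contain its infimum. *)
Lemma integral_tail_mean_min mu nu (b : bool) (m : R) (A : set R) : 0 <= m ->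
  A = [set` Interval (BSide b m) +oo%O] ->
  (\int[mu]_x (\1_A x * mean_min nu x)%:E <= (mean_min nu m)%:E * mu A +
   \int[lam]_(u in `[0%R, +oo[) (\1_A u * (tail mu u * tail nu u))%:E)%E.
Proof.
move=> m0 AE; pose TT (u : R) : R := tail mu u * tail nu u.
have mTT : measurable_fun setT TT by apply: measurable_funM; exact: measurable_tail.
have IE (b' : bool) : (\int[lam]_(u in `[0%R, +oo[)
      (\1_[set` Interval (BSide b' m) +oo%O] u * TT u)%:E =
    \int[lam]_(u in [set` Interval (BSide b' m) +oo%O]) (TT u)%:E)%E.
  rewrite [LHS]integral_mkcond [RHS]integral_mkcond; apply: eq_integral => u _.
  rewrite !patchE indicE !mem_setE [u \in `[0, +oo[]in_itv/= andbT.
  have [um|] := boolP (u \in Interval (BSide b' m) +oo%O); last first.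
    by rewrite mul0r; case: ifP.
  rewrite (le_trans m0) ?mul1r//.
  by move: um; case: b' => /=; rewrite in_itv/= andbT// => /ltW.
(* The right side is put over the closed ray in both cases, the endpoint being Lebesgue-null. *)
have -> : (\int[lam]_(u in `[0%R, +oo[) (\1_A u * (tail mu u * tail nu u))%:E =
    \int[lam]_(u in `[0%R, +oo[)
      ((\1_(`[m, +oo[%classic : set R) u * tail nu u)%:E * (tail mu u)%:E))%E.
  rewrite AE IE; transitivity (\int[lam]_(u in `[m, +oo[) (TT u)%:E)%E.
    case: (b) => //; apply: integral_itv_obnd_cbnd.
    by apply/measurable_EFinP; exact: measurable_funTS.
  rewrite -IE; apply: eq_integral => u _.
  by rewrite -EFinM /TT mulrCA mulrC.
have mI : measurable_fun setT (fun u => (\1_(`[m, +oo[%classic : set R) u * tail nu u)%:E).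
  apply/measurable_EFinP; apply: measurable_funM; first exact: measurable_indic.
  exact: measurable_tail.
have I0 u : (0 <= (\1_(`[m, +oo[%classic : set R) u * tail nu u)%:E)%E.
  by rewrite lee_fin mulr_ge0// tail_ge0.
rewrite -layer_cake//.
have mA : measurable A by rewrite AE.
have mIA : measurable_fun setT (\1_A : R -> R) by exact: measurable_indic.
have -> : ((mean_min nu m)%:E * mu A = \int[mu]_x (mean_min nu m * \1_A x)%:E)%E.
  under eq_integral do rewrite EFinM.
  rewrite ge0_integralZl_EFin//.
  - by rewrite integral_indic// setIT.
  - by apply/measurable_EFinP.
  - exact: mean_min_ge0.
rewrite -ge0_integralD//; last 4 first.
- by move=> x _; rewrite lee_fin mulr_ge0// mean_min_ge0.
- by apply/measurable_EFinP; apply: measurable_funM.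
- by move=> x _; exact: integral_ge0.
- exact: measurable_integral_itv0.
apply: ge0_le_integral => //.
- by move=> x _; rewrite lee_fin mulr_ge0// mean_min_ge0.
- by apply/measurable_EFinP; apply: measurable_funM => //; exact: measurable_mean_min.
- apply: emeasurable_funD; last exact: measurable_integral_itv0.
  by apply/measurable_EFinP; exact: measurable_funM.
move=> x _; rewrite indicE; case: (boolP (x \in A)) => xA; last first.
  by rewrite mul0r mulr0 add0e integral_ge0.
have mx : m <= x.
  by move: xA; rewrite AE mem_setE; case: (b) => /=; rewrite in_itv/= andbT// => /ltW.
rewrite mul1r mulr1 (mean_minD nu m0 mx) leeD2l//.
rewrite [leLHS]integral_mkcond [leRHS]integral_mkcond le_eqVlt; apply/orP; left; apply/eqP.
apply: eq_integral => u _.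
rewrite !patchE indicE !mem_setE !in_itv/= andbT.
have [mu_|um] := leP m u; last by rewrite mul0r; case: ifP.
by rewrite (le_trans m0 mu_) mul1r.
Qed.
End regular.

(** * The single-crossing argument *)

Section regular_law.
Set Implicit Arguments. Unset Strict Implicit. Unset Printing Implicit Defensive.
Context {R : realType}.
Local Notation lam := (@lebesgue_measure R).
Implicit Types mu nu : probability (measurableTypeR R) R.

Definition regular_law mu : Prop :=
  exists (alpha : R) (beta : \bar R) (f : R -> R),
    let I := [set t : R | alpha <= t /\ (t%:E <= beta)%E] in
    [/\ 0 <= alpha,
        (forall A : set R, measurable A ->
           mu A = (\int[lam]_(t in (A `&` I)) (f t)%:E)%E),
        ({within I, continuous f}),
        (forall t, I t -> 0 < f t) &
        (forall t u, I t -> I u -> t <= u ->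
           t - tail mu t / f t <= u - tail mu u / f u)].

(* The function [c] of the header, [phi] being the density of [mu]. *)
Definition excess mu nu (phi : R -> R) (r t : R) : R :=
  phi t * (mean_min nu t - r) - tail mu t * tail nu t.

(** Let [a] and [b] be the ratios [tail mu / f] at [s] and [t]. Positivity at [s] reads
    [a * tail nu s < mean_min nu s - r]. From [s] to [t] the right side gains at least
    [(t - s) * tail nu t], while regularity gives [b <= a + (t - s)]; hence
    [b * tail nu t <= mean_min nu t - r]. *)
Lemma excess_ge0_after mu nu (f : R -> R) (r s t : R) :
  0 <= s -> s <= t -> 0 < f s -> 0 < f t ->
  s - tail mu s / f s <= t - tail mu t / f t ->
  0 < excess mu nu f r s -> 0 <= excess mu nu f r t.
Proof.
rewrite /excess => s0 st fs ft reg.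
rewrite subr_gt0 -ltr_pdivrMl// => cs.
rewrite subr_ge0 -ler_pdivrMl//.
have := mean_min_incr_ge nu s0 st; have := tail_nincr nu st.
have := tail_ge0 nu t; have := tail_ge0 mu s.
have := divr_ge0 (tail_ge0 mu s) (ltW fs).
move: cs reg; rewrite !mulrA ![_^-1 * _]mulrC.
set a := tail mu s / f s; set b := tail mu t / f t => cs reg a0 _ n0 nn gg.
have : b * tail nu t <= (a + (t - s)) * tail nu t by rewrite ler_wpM2r//; lra.
have : a * tail nu t <= a * tail nu s by rewrite ler_wpM2l.
nra.
Qed.

(** As [c] changes sign once and [0 <= Q <= 1], the integral of [Q * c] is at most that of [c] over
    the ray [A] beyond the crossing point [m]. The latter is at most [mu A * (mean_min nu m - r2)],
    which the price [m] bounds by [r1 / e]. *)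
Lemma surplus_le mu nu (r1 r2 : R) (Q : R -> R) :
  regular_law mu -> 0 <= r1 -> 0 <= r2 ->
  (forall u, 0 <= u -> u * tail mu u <= r1) ->
  (forall u, 0 <= u -> u * tail nu u <= r2) ->
  measurable_fun setT Q -> (forall t, 0 <= Q t <= 1) ->
  (\int[mu]_x (mean_min nu x)%:E < +oo)%E ->
  (\int[mu]_x (Q x * mean_min nu x)%:E <= r2%:E * \int[mu]_x (Q x)%:E
    + (\int[lam]_(u in `[0%R, +oo[) (Q u * (tail mu u * tail nu u))%:E
       + (r1 / expR 1)%:E))%E.
Proof.
move=> [alpha [beta [f]]]; set I := [set t | _] => -[a0 muE cf f0 reg].
move=> r10 r20 mur1 nur2 mQ Q01 mean_min_fin.
have Q0 t : 0 <= Q t by case/andP: (Q01 t).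
have Q1 t : Q t <= 1 by case/andP: (Q01 t).
have mI : measurable I.
  apply: is_interval_measurable => x y [ax xb] [ay yb] z /andP[xz zy]; split.
    exact: le_trans xz.
  by apply: le_trans yb; rewrite lee_fin.
pose phi : R -> R := f \_ I.
have phiE t : I t -> phi t = f t by move=> It; rewrite /phi patchE mem_set.
have phiN t : ~ I t -> phi t = 0 by move=> It; rewrite /phi patchE memNset.
have mphi : measurable_fun setT phi.
  apply/(measurable_restrictT _ mI).
  exact: subspace_continuous_measurable_fun.
have phi0 t : 0 <= phi t.
  by have [It|nIt] := pselect (I t); [rewrite phiE// ltW// f0|rewrite phiN].
have muphi (A : set R) : measurable A -> mu A = (\int[lam]_(t in A) (phi t)%:E)%E.
  move=> mA; rewrite muE// [RHS]integral_mkcond [LHS]integral_mkcond.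
  apply: eq_integral => t _; rewrite !patchE in_setI /phi patchE.
  by case: (t \in A) => //=; case: (t \in I).
have phi_neg t : t < 0 -> phi t = 0.
  by move=> t0; apply: phiN => -[at_ _]; move: t0; rewrite ltNge (le_trans a0).
(* Right of the support both terms of [c] vanish, so [c] does not turn negative there. *)
have tail_out s t : I s -> s <= t -> ~ I t -> tail mu t = 0.
  move=> Is st nIt; apply/eqP; rewrite -eqe EFin_tail muE// (_ : _ `&` _ = set0) ?integral_set0//.
  rewrite -subset0 => u /=; rewrite in_itv/= andbT => -[tu [_ ub]]; apply: nIt; split.
    exact: le_trans (Is.1) st.
  by apply: le_trans ub; rewrite lee_fin.
pose c := excess mu nu phi r2.
have c_out t : ~ I t -> c t <= 0.
  by move=> nIt; rewrite /c /excess phiN// mul0r sub0r oppr_le0 mulr_ge0// tail_ge0.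
pose S := [set t | I t /\ 0 < c t].
have SI s : S s -> 0 <= s by move=> [[a_s _] _]; exact: le_trans a_s.
have c_after s t : S s -> s <= t -> 0 <= c t.
  move=> Ss st; have [Is cs] := Ss; have [It|nIt] := pselect (I t); last first.
    by rewrite /c /excess (tail_out s)// phiN// !mul0r subrr.
  move: cs; rewrite /c /excess !phiE//; apply: excess_ge0_after => //.
  - exact: SI.
  - exact: f0.
  - exact: f0.
  - exact: reg.
have c_S t : ~ S t -> c t <= 0.
  move=> nSt; have [It|/c_out//] := pselect (I t).
  by rewrite leNgt; apply/negP => ct; exact: nSt.
have real_of (e : \bar R) : (0 <= e)%E -> (e < +oo)%E -> exists2 x : R, e = x%:E & 0 <= x.
  by move=> e0 eoo; exists (fine e); rewrite ?fine_ge0// fineK// ge0_fin_numE.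
have mg := measurable_mean_min nu.
(* The integrals are shown to be real numbers, all bounded through the finite mean of the minimum or
   by a total mass of 1, so that the conclusion becomes real arithmetic. *)
have TTfin (w : R -> R) : measurable_fun setT w -> (forall t, 0 <= w t <= 1) ->
    exists2 x : R,
      (\int[lam]_(u in `[0%R, +oo[) (w u * (tail mu u * tail nu u))%:E = x%:E)%E & 0 <= x.
  move=> mw w01; apply: real_of; first apply: integral_ge0.
    by move=> u _; rewrite lee_fin; case/andP: (w01 u) => ? _; rewrite !mulr_ge0// tail_ge0.
  apply: le_lt_trans mean_min_fin; rewrite integral_mean_min; apply: ge0_le_integral => //.
  - by move=> u _; rewrite lee_fin; case/andP: (w01 u) => ? _; rewrite !mulr_ge0// tail_ge0.
  - apply/measurable_EFinP; apply: measurable_funTS.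
    by do ?[apply: measurable_funM => //; try exact: measurable_tail].
  - apply/measurable_EFinP; apply: measurable_funTS.
    by do ?[apply: measurable_funM => //; try exact: measurable_tail].
  - move=> u _; rewrite lee_fin; case/andP: (w01 u) => _ w1.
    by rewrite ler_piMl// mulr_ge0// tail_ge0.
have [b bE b0] := TTfin Q mQ Q01.
have [q qE q0] : exists2 q : R, (\int[mu]_x (Q x)%:E = q%:E)%E & 0 <= q.
  apply: real_of; first by apply: integral_ge0 => x _; rewrite lee_fin.
  apply: (@le_lt_trans _ _ 1%E); last by rewrite ltry.
  rewrite -(@probability_setT _ _ _ mu) -[leRHS]mul1e -integral_cst//.
  apply: ge0_le_integral => //.
  - by move=> x _; rewrite lee_fin.
  - exact/measurable_EFinP.
  - by move=> x _; rewrite lee_fin.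
have [X XE X0] : exists2 X : R, (\int[mu]_x (Q x * mean_min nu x)%:E = X%:E)%E & 0 <= X.
  apply: real_of; first by apply: integral_ge0 => x _; rewrite lee_fin mulr_ge0// mean_min_ge0.
  apply: le_lt_trans mean_min_fin; apply: ge0_le_integral => //.
  - by move=> x _; rewrite lee_fin mulr_ge0// mean_min_ge0.
  - by apply/measurable_EFinP; exact: measurable_funM.
  - exact/measurable_EFinP.
  - by move=> x _; rewrite lee_fin ler_piMl// mean_min_ge0.
rewrite XE qE bE -EFinM -!EFinD lee_fin.
have weights := le_integral_weights (nu := nu) r20 mphi phi0 muphi phi_neg.
(* If [c] is nowhere positive, the comparison weight is 0. *)
have [S0|/contrapT Sn0] := pselect (~ (S !=set0)).
  have mu0 : (\int[mu]_x (0 * mean_min nu x)%:E = 0)%E.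
    by apply: integral0_eq => x _; rewrite mul0r.
  have := weights (cst 0) Q (@measurable_cst _ _ _ _ _ _) (fun=> lexx _) mQ Q0.
  rewrite XE qE bE /= mu0 adde0 integral_cst// mul0e mule0 adde0.
  rewrite integral0_eq ?adde0; last by move=> x _; rewrite mul0r.
  rewrite -EFinM -EFinD lee_fin => /(_ _)/le_trans; apply.
    move=> t t0; rewrite subr0 mulr_ge0_le0//; apply: c_S => St.
    by apply: S0; exists t.
  by rewrite addrA lerDl divr_ge0// expR_ge0.
have Sinf : has_inf S by split=> //; exists 0 => s /SI.
pose m := inf S; have m0 : 0 <= m by apply: lb_le_inf => // s /SI.
(* The endpoint lies in [A] exactly when it lies in [S]: thus [A] contains [S], and every point of
   [A] has a point of [S] at or below it. *)
pose A : set R := [set` Interval (BSide `[< S m >] m) +oo%O].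
have AS t : A t -> exists2 s, S s & s <= t.
  rewrite /A/= in_itv/= andbT; case: asboolP => Sm /= mt; first by exists m.
  by have [s Ss st] := inf_lt Sn0 mt; exists s => //; exact: ltW.
have SA t : S t -> A t.
  move=> St; have mt : m <= t by apply: ge_inf => //; exact: Sinf.2.
  rewrite /A/= in_itv/= andbT; case: asboolP => //= nSm.
  by rewrite lt_neqAle mt andbT; apply/eqP => mtE; apply: nSm; rewrite mtE.
have mA : measurable A by exact: measurable_itv.
have mIA : measurable_fun setT (\1_A : R -> R) by exact: measurable_indic.
have A01 t : 0 <= (\1_A t : R) <= 1 by rewrite indicE; case: (t \in A); rewrite ?lexx ler01.
have A0 t : 0 <= (\1_A t : R) by case/andP: (A01 t).
have [y yE y0] := TTfin (\1_A) mIA A01.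
have muA : (\int[mu]_x (\1_A x)%:E = mu A)%E by rewrite integral_indic// setIT.
have [a aE a_ge0] : exists2 a : R, mu A = a%:E & 0 <= a.
  by apply: real_of; rewrite ?measure_ge0// (le_lt_trans (probability_le1 _ _)) ?ltry.
have am : a <= tail mu m.
  rewrite -lee_fin EFin_tail -aE; apply: le_measure; rewrite ?inE//.
  move=> t /AS[s Ss st]; rewrite /= in_itv/= andbT (le_trans _ st)//.
  by apply: ge_inf => //; exact: Sinf.2.
(* By [mean_min_le] the second factor is at most [m / e], and [a * m] is at most the revenue
   [m * tail mu m] of the price [m]. *)
have : a * (mean_min nu m - r2) <= r1 / expR 1.
  apply: (@le_trans _ _ (a * (m / expR 1))).
    by rewrite ler_wpM2l// lerBlDl; exact: mean_min_le.
  rewrite mulrA ler_pM2r ?invr_gt0 ?expR_gt0//.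
  by rewrite (le_trans _ (mur1 _ m0))// mulrC ler_wpM2l.
have := integral_tail_mean_min mu nu m0 (erefl A); have := weights (\1_A) Q mIA A0 mQ Q0.
rewrite XE qE bE yE muA aE -!EFinM -EFinD => H zle.
have [z zE _] : exists2 z, (\int[mu]_x (\1_A x * mean_min nu x)%:E = z%:E)%E & 0 <= z.
  apply: real_of; last by apply: le_lt_trans zle _; exact: ltry.
  by apply: integral_ge0 => x _; rewrite lee_fin mulr_ge0// mean_min_ge0.
move: H zle; rewrite zE -!EFinD !lee_fin => H zle.
have {}H : X + (y + r2 * a) <= r2 * q + (b + z).
  apply: H => t t0; case: (boolP (t \in A)) => tA; rewrite indicE ?tA ?(negbTE tA)/=.
    have [s Ss st] := AS _ (set_mem tA).
    by rewrite mulr_le0_ge0 ?subr_le0//; exact: c_after st.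
  rewrite subr0 mulr_ge0_le0//; apply: c_S => /SA /mem_set.
  by rewrite (negbTE tA).
nra.
Qed.
End regular_law.

(** * Mechanisms *)

Section mechanisms.
Set Implicit Arguments. Unset Strict Implicit. Unset Printing Implicit Defensive.
Context {R : realType}.
Local Notation lam := (@lebesgue_measure R).
Implicit Types mu nu : probability (measurableTypeR R) R.
Implicit Types q s : R * R -> R.

(** Exchange of the two goods: what is proved for [y <= x] then serves on the other side of the
    diagonal. *)
Definition swapped (g : R * R -> R) (z : R * R) : R := g (z.2, z.1).

Lemma mech2_swapped q1 q2 s :
  mech2 q1 q2 s -> mech2 (swapped q2) (swapped q1) (swapped s).
Proof.
move=> [[m1 m2 ms] q01 ir ic]; split.
- by split; apply: measurableT_comp => //; exact: measurable_swap.
- by move=> x; have [] := q01 (x.2, x.1).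
- by move=> x x1 x2; have := ir (x.2, x.1) x2 x1; rewrite /swapped/=; lra.
- move=> x x' x1 x2 x1' x2'.
  by have := ic (x.2, x.1) (x'.2, x'.1) x2 x1 x2' x1'; rewrite /swapped/=; lra.
Qed.

Definition diag (g : R * R -> R) (t : R) : R := g (t, t).

Definition diag_payoff q1 q2 s (t : R) : R :=
  (diag q1 t + diag q2 t) * t - diag s t.

(* The payment for the first good alone (the second one being bought at its
   value [z.2]) in excess of what type [(z.2, z.2)] pays for it. *)
Definition extra_pay q2 s (z : R * R) : R :=
  if (0 <= z.2) && (z.2 <= z.1) then
    (s z - z.2 * q2 z) - (diag s z.2 - z.2 * diag q2 z.2)
  else 0.

Lemma measurable_diag (g : R * R -> R) :
  measurable_fun setT g -> measurable_fun setT (diag g).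
Proof.
move=> mg; apply: measurableT_comp => //.
by apply/measurable_fun_pairP; split; exact: measurable_id.
Qed.

Lemma measurable_extra_pay q2 s : measurable_fun setT q2 -> measurable_fun setT s ->
  measurable_fun setT (extra_pay q2 s).
Proof.
move=> mq ms.
have m2 : measurable_fun setT (snd : R * R -> R) by exact: measurable_snd.
apply: measurable_fun_ifT => //=.
  by apply: measurable_and; apply: measurable_fun_ler.
do 2 apply: measurable_funB => //.
- exact: measurable_funM.
- by apply: (measurableT_comp (measurable_diag ms)).
- by apply: measurable_funM => //; apply: (measurableT_comp (measurable_diag mq)).
Qed.

(** Type [(y, y)] does not gain by reporting [(x, y)], so the extra payment is at least
    [y * (q1 (x, y) - q1 (y, y))]; the converse constraint makes this difference nonnegative. *)
Lemma extra_pay_ge0 q1 q2 s z : mech2 q1 q2 s -> 0 <= extra_pay q2 s z.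
Proof.
case: z => x y [_ q01 _ ic]; rewrite /extra_pay /diag /=.
case: ifP => // /andP[y0 yx]; have x0 := le_trans y0 yx.
have := ic (x, y) (y, y) x0 y0 y0 y0; have := ic (y, y) (x, y) y0 y0 x0 y0.
rewrite /=; move: yx; rewrite le_eqVlt => /predU1P[->|yx] H1 H2; first by rewrite subrr.
nra.
Qed.

(** With [q2 (x, y)] in place of [diag q2 x] this is an identity. Incentive compatibility between
    [(x, y)] and [(x, x)] makes [q2] nondecreasing in the second value. *)
Lemma payment_le q1 q2 s x y : mech2 q1 q2 s -> 0 <= y -> y <= x ->
  s (x, y) + diag_payoff q1 q2 s y
    <= extra_pay q2 s (x, y) + y * diag q1 y + y * diag q2 x.
Proof.
move=> [_ q01 _ ic] y0 yx; have x0 := le_trans y0 yx.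
have H1 := ic (x, y) (x, x) x0 y0 x0 x0; have H2 := ic (x, x) (x, y) x0 x0 x0 y0.
rewrite /extra_pay /diag_payoff /diag /= y0 yx/=.
rewrite /= in H1 H2.
move: yx; rewrite le_eqVlt => /predU1P[yx|yx]; first by rewrite yx; nra.
have : q2 (x, y) <= q2 (x, x) by nra.
move=> /(ler_wpM2l y0); lra.
Qed.

(** On either side of the diagonal one [extra_pay] term comes from [payment_le] and the other is
    nonnegative. *)
Lemma payment_le_sum q1 q2 s x y : mech2 q1 q2 s -> 0 <= x -> 0 <= y ->
  s (x, y) + diag_payoff q1 q2 s (pmin x y)
    <= (extra_pay q2 s (x, y) + extra_pay (swapped q1) (swapped s) (y, x))
       + (pmin x y * diag q1 y + pmin x y * diag q2 x).
Proof.
move=> M x0 y0; have M' := mech2_swapped M.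
have -> : pmin x y = Num.min x y by rewrite /pmin; apply/max_idPr; rewrite le_min x0.
have [xy|yx] := leP x y.
  have := payment_le M' x0 xy; have := extra_pay_ge0 (x, y) M.
  rewrite /diag_payoff /diag /swapped/=; lra.
have := payment_le M y0 (ltW yx); have := extra_pay_ge0 (y, x) M'; lra.
Qed.

Lemma diag_payoff_subgradient q1 q2 s t u : mech2 q1 q2 s -> 0 <= t -> 0 <= u ->
  diag_payoff q1 q2 s t + (diag q1 t + diag q2 t) * (u - t) <= diag_payoff q1 q2 s u.
Proof.
move=> [_ _ _ ic] t0 u0; have := ic (u, u) (t, t) u0 u0 t0 t0.
by rewrite /diag_payoff /diag/=; lra.
Qed.

(** Riemann sums. The subgradient inequality makes [h] nondecreasing, so a cell of width [d]
    contributes at most [d] times [h] at its right end, while [d] times [h] at its left end is at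
    most the increment of [beta]. Shifting the sum by one cell leaves an error of at most
    [d * h z]. *)
Lemma integral_subgradient_le (beta h : R -> R) (z : R) :
  measurable_fun setT h -> (forall t, 0 <= h t <= 2) ->
  (forall t u, 0 <= t -> 0 <= u -> beta t + h t * (u - t) <= beta u) ->
  0 <= z -> (\int[lam]_(u in `[0%R, z]) (h u)%:E <= (beta z - beta 0)%:E)%E.
Proof.
move=> mh h02 sub z0.
have h0 t : 0 <= h t by case/andP: (h02 t).
have mhE (A : set R) : measurable_fun A (fun u => (h u)%:E).
  by apply/measurable_EFinP; exact: measurable_funTS.
have mono t u : 0 <= t -> t <= u -> h t <= h u.
  move=> t0; rewrite le_eqVlt => /predU1P[->//|tu].
  have u0 : 0 <= u by rewrite (le_trans t0)// ltW.
  by have := sub _ _ t0 u0; have := sub _ _ u0 t0; nra.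
have step (d : R) (k : nat) : 0 <= d ->
    (\int[lam]_(u in `[0%R, (k%:R * d)%R]) (h u)%:E
      <= (beta (k%:R * d) - beta 0 + d * h (k%:R * d))%:E)%E.
  move=> d0; elim: k => [|k IH].
    rewrite mul0r set_itv1 integral_set1 lee_fin subrr add0r.
    by rewrite mulr_ge0.
  set a := k%:R * d; have a0 : 0 <= a by rewrite mulr_ge0.
  set c := k.+1%:R * d; have cE : c = a + d by rewrite /c -natr1 mulrDl mul1r.
  have ac : a <= c by rewrite cE lerDl.
  rewrite (@itv_bndbnd_setU _ _ _ (BRight a)) ?bnd_simp// ge0_integral_setU//=.
  - apply: (@le_trans _ _ ((beta a - beta 0 + d * h a)%:E + (h c * d)%:E)%E).
      apply: leeD; first exact: IH.
      rewrite integral_itv_obnd_cbnd; last exact: mhE.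
      have -> : ((h c * d)%:E = \int[lam]_(u in `[a, c]) cst (h c)%:E u)%E.
        rewrite integral_cst//= lebesgue_measure_itv/= lte_fin EFinM; congr (_ * _)%E.
        rewrite -EFinB cE addrAC subrr add0r; case: ltP => //.
        by rewrite gerDl => d0'; congr EFin; apply/le_anti; rewrite d0 d0'.
      apply: ge0_le_integral => //=.
      - by move=> u _; rewrite lee_fin.
      - exact: mhE.
      - move=> u; rewrite in_itv/= lee_fin => /andP[au uc].
        by apply: mono uc; exact: le_trans au.
    rewrite -EFinD lee_fin.
    have := sub a c a0 (le_trans a0 ac); rewrite cE; lra.
  - exact: mhE.
  - by move=> u _; rewrite lee_fin.
  - by apply: lt_disjoint => u v; rewrite !in_itv/= => /andP[_ ux] /andP[xv _];
    exact: le_lt_trans xv.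
apply/lee_addgt0Pr => eps eps0.
(* As [h <= 2], the error is at most [2 * z / N], which this [N] brings below [eps]. *)
pose N := (Num.truncn (2 * z / eps)).+1.
have N0 : 0 < N%:R :> R by rewrite ltr0n.
have zd : N%:R * (z / N%:R) = z by rewrite mulrC divfK// gt_eqF.
have := @step (z / N%:R) N (divr_ge0 z0 (ltW N0)); rewrite zd => /le_trans; apply.
rewrite lee_fin lerD2l; case/andP: (h02 z) => hz0 hz2.
have := truncnS_gt (2 * z / eps); rewrite -/N ltr_pdivrMr// => zN.
rewrite mulrAC ler_pdivrMr// (le_trans _ (ltW (lt_le_trans zN _)))//; last by rewrite mulrC.
by rewrite mulrC ler_wpM2r.
Qed.

(** Payments are taken nonnegative so that the integral passes between a random variable and its law
    without integrability conditions. Posted prices and rescaled extra payments are of this kind. *)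
Definition revenue_le mu (r : R) : Prop :=
  forall q s : R -> R, mech1 q s -> (forall x, 0 <= s x) ->
  (\int[mu]_x (s x)%:E <= r%:E)%E.

Lemma revenue_le_ge0 mu r : revenue_le mu r -> 0 <= r.
Proof.
move=> /(_ (cst 0) (cst 0)) H; rewrite -lee_fin.
apply: le_trans (H _ _); [exact: integral_ge0| |by []].
split=> //=; try exact: measurable_cst; try by move=> *; rewrite ?mul0r ?subrr ?lexx ?ler01.
Qed.

(** The left side is the revenue of the posted price [u]. *)
Lemma revenue_le_tail mu r u : revenue_le mu r -> 0 <= u -> u * tail mu u <= r.
Proof.
move=> H u0; pose q := \1_(`[u, +oo[%classic) : R -> R.
have mq : measurable_fun setT q by exact: measurable_indic.
have qE x : q x = if u <= x then 1 else 0.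
  by rewrite /q indicE mem_setE in_itv/= andbT; case: ifP.
rewrite -lee_fin EFinM EFin_tail.
have -> : (u%:E * mu `[u, +oo[%classic = \int[mu]_x (u * q x)%:E)%E.
  under eq_integral do rewrite EFinM.
  rewrite ge0_integralZl_EFin//.
  - by rewrite integral_indic// setIT.
  - by move=> x _; rewrite lee_fin qE; case: ifP.
  - exact/measurable_EFinP.
apply: (H q) => [|x]; last by rewrite mulr_ge0// qE; case: ifP.
split=> //.
- exact: measurable_funM.
- by move=> x; rewrite qE; case: ifP; rewrite ?lexx ler01.
- by move=> x x0; rewrite qE; case: ifP => ux; rewrite ?mul1r ?mul0r ?mulr1 ?mulr0 ?subr_ge0 ?subrr.
- move=> x x' x0 x0'; rewrite !qE; by case: (leP u x); case: (leP u x') => /=; lra.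
Qed.

(** For fixed [y], the extra payment and the extra allocation over that of type [(y, y)] form a
    one-good mechanism whose allocation is at most [k = 1 - diag q1 y]. Dividing both by [k] gives a
    mechanism for [mu], of revenue at most [r]. *)
Lemma integral_extra_pay mu r q1 q2 s y : revenue_le mu r -> mech2 q1 q2 s ->
  (\int[mu]_x (extra_pay q2 s (x, y))%:E <= (r * (1 - diag q1 y))%:E)%E.
Proof.
move=> H M; have r0 := revenue_le_ge0 H.
have e0 x := extra_pay_ge0 (x, y) M.
have [[mq1 mq2 ms] q01 _ ic] := M.
have [/andP[Q0 Q1] _] := q01 (y, y).
have [y0|y0] := leP 0 y; last first.
  rewrite integral0_eq ?lee_fin ?mulr_ge0// ?subr_ge0// => x _.
  by rewrite /extra_pay/= leNgt y0.
pose e x := extra_pay q2 s (x, y).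
(* Types below [y] get nothing and pay nothing; so does type [y] itself, which yields individual
   rationality. *)
pose n x := if y <= x then q1 (x, y) - diag q1 y else 0.
have me : measurable_fun setT e.
  by apply: (measurable_fun_pair1 y); exact: measurable_extra_pay.
have mn : measurable_fun setT n.
  apply: measurable_fun_ifT => //=; first exact: measurable_fun_ler.
  by apply: measurable_funB => //; exact: measurable_fun_pair1.
have n0 x : 0 <= n x.
  rewrite /n; case: ifP => // yx; have x0 := le_trans y0 yx; rewrite /diag.
  have := ic (x, y) (y, y) x0 y0 y0 y0; have := ic (y, y) (x, y) y0 y0 x0 y0.
  rewrite /= => h1 h2; move: yx; rewrite le_eqVlt => /predU1P[->|yx]; first by rewrite subrr.
  nra.
have nle x : n x <= 1 - diag q1 y.
  by rewrite /n; case: ifP => _; [rewrite lerD2r; have [/andP[]] := q01 (x, y)|rewrite subr_ge0].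
have IC x x' : 0 <= x -> 0 <= x' -> n x' * x - e x' <= n x * x - e x.
  move=> x0 x0'; rewrite /n /e /extra_pay/= y0/= /diag.
  have h1 := ic (x, y) (x', y) x0 y0 x0' y0; have h2 := ic (y, y) (x', y) y0 y0 x0' y0.
  have h3 := ic (x, y) (y, y) x0 y0 y0 y0.
  have := n0 x'; rewrite /n /diag; move: h1 h2 h3 => /=.
  case: ifP => [yx'|_]; case: ifP => [yx|/negbT]; rewrite -?ltNge; nra.
(* Without room for extra allocation, the option of reporting [y] forces the extra payment to be
   zero. *)
have [k0|] := leP (1 - diag q1 y) 0.
  have k1 : 1 - diag q1 y = 0 by apply/le_anti; rewrite k0 subr_ge0.
  rewrite k1 mulr0 integral0_eq// => x _; congr EFin; apply/le_anti; rewrite e0 andbT.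
  have [yx|xy] := leP y x; last by rewrite /extra_pay/= [y <= x]leNgt xy andbF.
  have := IC x y (le_trans y0 yx) y0.
  have n00 x' : n x' = 0 by apply/le_anti; rewrite n0 (le_trans (nle _))// k1.
  rewrite !n00 !mul0r !sub0r lerN2 /e {2}/extra_pay/= lexx y0/=.
  by rewrite /diag subrr.
set k := 1 - diag q1 y => k_gt0.
have -> : (\int[mu]_x (e x)%:E = k%:E * \int[mu]_x (e x / k)%:E)%E.
  rewrite -ge0_integralZl_EFin//.
  - by apply: eq_integral => x _; rewrite -EFinM mulrC divfK// gt_eqF.
  - by move=> x _; rewrite lee_fin divr_ge0 ?(ltW k_gt0)// e0.
  - by apply/measurable_EFinP; apply: measurable_funM.
  - exact: ltW.
rewrite (mulrC r) EFinM lee_wpmul2l ?lee_fin ?(ltW k_gt0)//.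
have aff x x' : n x / k * x' - e x / k = (n x * x' - e x) / k by rewrite mulrBl mulrAC.
apply: (H (fun x => n x / k)) => [|x]; last by rewrite divr_ge0 ?(ltW k_gt0)// e0.
split.
- exact: measurable_funM.
- exact: measurable_funM.
- by move=> x; rewrite divr_ge0 ?(ltW k_gt0)//= ler_pdivrMr// mul1r nle.
- move=> x x0; rewrite aff divr_ge0 ?(ltW k_gt0)//.
  apply: le_trans (IC x y x0 y0).
  rewrite /n lexx /diag subrr mul0r sub0r /e /extra_pay/= lexx y0/= /diag.
  by rewrite subrr oppr0.
- by move=> x x' x0 x0'; rewrite !aff ler_pM2r ?invr_gt0// IC.
Qed.

End mechanisms.

(** * The bound under the product law *)

Section product_bound.
Set Implicit Arguments. Unset Strict Implicit. Unset Printing Implicit Defensive.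
Context {R : realType}.
Local Notation lam := (@lebesgue_measure R).
Implicit Types mu nu : probability (measurableTypeR R) R.
Implicit Types q s : R * R -> R.

Lemma pminC (x y : R) : pmin x y = pmin y x.
Proof. by rewrite /pmin minC. Qed.

Lemma pmin_ge0 (x y : R) : 0 <= pmin x y.
Proof. by rewrite /pmin le_max lexx. Qed.

Lemma measurable_pmin : measurable_fun setT (fun z : R * R => pmin z.1 z.2).
Proof.
apply: measurable_maxr => //; apply: measurable_minr.
- exact: measurable_fst.
- exact: measurable_snd.
Qed.

Lemma measurable_swapped (g : R * R -> R) :
  measurable_fun setT g -> measurable_fun setT (swapped g).
Proof. by move=> mg; apply: measurableT_comp => //; exact: measurable_swap. Qed.

Lemma ge0_integral_le_cst mu (g : R -> \bar R) (r : R) : measurable_fun setT g ->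
  (forall x, 0 <= g x)%E -> (forall x, g x <= r%:E)%E -> (\int[mu]_x g x <= r%:E)%E.
Proof.
move=> mg g0 gr; rewrite -[leRHS]mule1 -(@probability_setT _ _ _ mu) -integral_cst//.
by apply: ge0_le_integral => //; exact: measurable_cst.
Qed.

Lemma integral_pmin mu nu :
  (\int[mu \x nu]_z (pmin z.1 z.2)%:E = \int[mu]_x (mean_min nu x)%:E)%E.
Proof.
rewrite fubini_tonelli1//=.
- by apply: eq_integral => x _; rewrite -integral_min; apply: eq_integral => y _; rewrite pminC.
- by apply/measurable_EFinP; exact: measurable_pmin.
- by move=> z; rewrite lee_fin pmin_ge0.
Qed.

(** The minimum is at most [y] on [0 <= y <= x] plus [x] on [0 <= x <= y]. For a fixed value of one
    good, each term integrates to the revenue of a posted price for the other good. All finiteness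
    below rests on this bound. *)
Lemma integral_mean_min_le mu nu r1 r2 : revenue_le mu r1 -> revenue_le nu r2 ->
  (\int[mu]_x (mean_min nu x)%:E <= (r1 + r2)%:E)%E.
Proof.
move=> H1 H2.
pose low (z : R * R) : R := if (0 <= z.2) && (z.2 <= z.1) then z.2 else 0.
have m1 : measurable_fun setT (fst : R * R -> R) by exact: measurable_fst.
have m2 : measurable_fun setT (snd : R * R -> R) by exact: measurable_snd.
have mlow : measurable_fun setT low.
  apply: measurable_fun_ifT => //.
  by apply: measurable_and; apply: measurable_fun_ler.
have low0 z : 0 <= low z by rewrite /low; case: ifP => // /andP[].
have slow0 z : 0 <= swapped low z by exact: low0.
have lowE mu' r y : revenue_le mu' r -> (\int[mu']_x (low (x, y))%:E <= r%:E)%E.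
  move=> H; have [y0|y0] := leP 0 y; last first.
    rewrite integral0_eq ?lee_fin ?(revenue_le_ge0 H)// => x _.
    by rewrite /low/= leNgt y0.
  have -> : (\int[mu']_x (low (x, y))%:E = \int[mu']_(x in `[y, +oo[) cst y%:E x)%E.
    rewrite [RHS]integral_mkcond; apply: eq_integral => x _.
    by rewrite patchE mem_setE in_itv/= andbT /low/= y0/=; case: ifP.
  by rewrite integral_cst//= -EFin_tail -EFinM lee_fin revenue_le_tail.
have mlowE : measurable_fun setT (EFin \o low) by exact/measurable_EFinP.
have mslowE : measurable_fun setT (EFin \o swapped low).
  by apply/measurable_EFinP; exact: measurable_swapped.
rewrite -integral_pmin.
apply: (@le_trans _ _ (\int[mu \x nu]_z ((low z)%:E + (swapped low z)%:E))%E).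
  apply: ge0_le_integral => //.
  - by move=> z _; rewrite lee_fin pmin_ge0.
  - by apply/measurable_EFinP; exact: measurable_pmin.
  - exact: emeasurable_funD.
  - move=> [x y] _; rewrite -EFinD lee_fin; have := low0 (x, y); have := low0 (y, x).
    rewrite /swapped /pmin ge_max => l1 l2; rewrite addr_ge0//=.
    have [xy|/ltW yx] := leP x y.
    + have [x0|x0] := leP 0 x; last by rewrite (le_trans (ltW x0))// addr_ge0.
      by rewrite [low (y, x)]/low/= x0 xy lerDr.
    + have [y0|y0] := leP 0 y; last by rewrite (le_trans (ltW y0))// addr_ge0.
      by rewrite [low (x, y)]/low/= y0 yx lerDl.
rewrite ge0_integralD//; try by move=> z _; rewrite lee_fin low0.
rewrite EFinD leeD//.
- rewrite fubini_tonelli2//.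
  apply: ge0_integral_le_cst.
  + by apply: measurable_fun_fubini_tonelli_G => // z; rewrite lee_fin low0.
  + by move=> y; apply: integral_ge0 => x _; rewrite lee_fin.
  + by move=> y; exact: lowE.
- rewrite fubini_tonelli1//.
  apply: ge0_integral_le_cst.
  + by apply: measurable_fun_fubini_tonelli_F => // z; rewrite lee_fin low0.
  + by move=> x; apply: integral_ge0 => y _; rewrite lee_fin low0.
  + by move=> x; exact: lowE.
Qed.

Lemma integral_swapped mu nu (g : R * R -> R) : measurable_fun setT g ->
  (forall z, 0 <= g z) ->
  (\int[mu \x nu]_z (swapped g z)%:E = \int[nu \x mu]_z (g z)%:E)%E.
Proof.
move=> mg g0; rewrite fubini_tonelli1//.
- by rewrite fubini_tonelli2//; exact/measurable_EFinP.
- by apply/measurable_EFinP; exact: measurable_swapped.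
- by move=> z; exact: g0.
Qed.

Lemma integral_extra_pay_prod mu nu r q1 q2 s : revenue_le mu r -> mech2 q1 q2 s ->
  (\int[mu \x nu]_z (extra_pay q2 s z)%:E + r%:E * \int[nu]_y (diag q1 y)%:E
    <= r%:E)%E.
Proof.
move=> H M; have r0 := revenue_le_ge0 H; have e0 z := extra_pay_ge0 z M.
have [[mq1 mq2 ms] q01 _ _] := M; have mQ := measurable_diag mq1.
have Q0 y : 0 <= diag q1 y by have [/andP[]] := q01 (y, y).
have Q1 y : diag q1 y <= 1 by have [/andP[]] := q01 (y, y).
have me : measurable_fun setT (fun z => (extra_pay q2 s z)%:E).
  by apply/measurable_EFinP; exact: measurable_extra_pay.
rewrite fubini_tonelli2//=.
apply: (@le_trans _ _ (\int[nu]_y (r * (1 - diag q1 y))%:E + r%:E * \int[nu]_y (diag q1 y)%:E)%E).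
  rewrite leeD2r//; apply: ge0_le_integral => //.
  - by move=> y _; apply: integral_ge0 => x _; rewrite lee_fin.
  - exact: measurable_fun_fubini_tonelli_G.
  - by apply/measurable_EFinP; apply: measurable_funM => //; exact: measurable_funB.
  - by move=> y _; exact: integral_extra_pay.
rewrite -ge0_integralZl_EFin//; last 2 first.
- by move=> y _; rewrite lee_fin.
- exact/measurable_EFinP.
rewrite -ge0_integralD//; last 4 first.
- by move=> y _; rewrite lee_fin mulr_ge0// subr_ge0.
- by apply/measurable_EFinP; apply: measurable_funM => //; exact: measurable_funB.
- by move=> y _; rewrite mule_ge0// lee_fin.
- by apply: emeasurable_funM => //; exact/measurable_EFinP.
apply: ge0_integral_le_cst.
- apply: emeasurable_funD; last by apply: emeasurable_funM => //; exact/measurable_EFinP.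
  by apply/measurable_EFinP; apply: measurable_funM => //; exact: measurable_funB.
- by move=> y; rewrite -EFinM -EFinD lee_fin addr_ge0// mulr_ge0// subr_ge0.
- by move=> y; rewrite -EFinM -EFinD lee_fin; lra.
Qed.

Lemma integral_pmin_mul mu nu (Q : R -> R) : measurable_fun setT Q ->
  (forall y, 0 <= Q y) ->
  (\int[mu \x nu]_z (pmin z.1 z.2 * Q z.2)%:E = \int[nu]_y (Q y * mean_min mu y)%:E)%E.
Proof.
move=> mQ Q0; rewrite fubini_tonelli2//=.
- apply: eq_integral => y _; rewrite /fubini_G/= EFinM -integral_min.
  rewrite -ge0_integralZl_EFin//.
  + by apply: eq_integral => x _; rewrite -EFinM mulrC.
  + by move=> x _; rewrite lee_fin pmin_ge0.
  + apply/measurable_EFinP; exact: (measurable_fun_pair1 y measurable_pmin).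
- apply/measurable_EFinP; apply: measurable_funM; first exact: measurable_pmin.
  by apply: measurableT_comp => //; exact: measurable_snd.
- by move=> z; rewrite lee_fin mulr_ge0// pmin_ge0.
Qed.

(** The layer cake formula, once in each variable, turns the left side into the mean of the integral
    of [h] from 0 to the minimum. *)
Lemma integral_tails_le mu nu (h : R -> R) (W : R -> R) : measurable_fun setT h ->
  (forall u, 0 <= h u) -> measurable_fun setT W ->
  (forall z, 0 <= z -> (\int[lam]_(u in `[0%R, z]) (h u)%:E <= (W z)%:E)%E) ->
  (\int[lam]_(u in `[0%R, +oo[) (h u * (tail mu u * tail nu u))%:E
   <= \int[mu \x nu]_z (W (pmin z.1 z.2))%:E)%E.
Proof.
move=> mh h0 mW hW.
have mt (mu' : probability (measurableTypeR R) R) := measurable_tail mu'.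
have W0 z : 0 <= z -> 0 <= W z.
  move=> z0; rewrite -lee_fin; apply: le_trans (hW _ z0).
  by apply: integral_ge0 => u _; rewrite lee_fin.
have mWp : measurable_fun setT (fun z : R * R => (W (pmin z.1 z.2))%:E).
  by apply/measurable_EFinP; apply: measurableT_comp => //; exact: measurable_pmin.
have Wp0 z : (0 <= (W (pmin z.1 z.2))%:E)%E by rewrite lee_fin W0// pmin_ge0.
have -> : (\int[lam]_(u in `[0%R, +oo[) (h u * (tail mu u * tail nu u))%:E =
    \int[mu]_x \int[lam]_(u in `[0%R, x]) (h u * tail nu u)%:E)%E.
  rewrite layer_cake.
  - by apply: eq_integral => u _; rewrite -EFinM -mulrA (mulrC (tail nu u)).
  - by apply/measurable_EFinP; exact: measurable_funM.
  - by move=> u; rewrite lee_fin mulr_ge0// tail_ge0.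
rewrite fubini_tonelli1//.
apply: ge0_le_integral => //.
- by move=> x _; apply: integral_ge0 => u _; rewrite lee_fin mulr_ge0// tail_ge0.
- apply: measurable_integral_itv0; last by move=> u; rewrite lee_fin mulr_ge0// tail_ge0.
  by apply/measurable_EFinP; exact: measurable_funM.
- exact: measurable_fun_fubini_tonelli_F.
move=> x _; rewrite /fubini_F/=.
pose g (u : R) := (h u * \1_(`[0, x]%classic : set R) u)%:E.
have mg : measurable_fun setT g.
  by apply/measurable_EFinP; apply: measurable_funM => //; exact: measurable_indic.
have g0 u : (0 <= g u)%E by rewrite lee_fin mulr_ge0.
have -> : (\int[lam]_(u in `[0%R, x]) (h u * tail nu u)%:E =
    \int[nu]_y \int[lam]_(u in `[0%R, y]) g u)%E.
  rewrite layer_cake// [LHS]integral_mkcond [RHS]integral_mkcond.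
  apply: eq_integral => u _; rewrite !patchE /g indicE !mem_setE !in_itv/= andbT.
  case: (0 <= u) => //=; case: (u <= x) => /=; rewrite -?EFinM ?mulr1//.
  by rewrite mulr0 mul0r.
apply: ge0_le_integral => //.
- by move=> y _; exact: integral_ge0.
- exact: measurable_integral_itv0.
- exact: (measurable_fun_pair2 x mWp).
move=> y _; apply: le_trans (hW _ (pmin_ge0 _ _)).
rewrite [leLHS]integral_mkcond [leRHS]integral_mkcond.
apply: ge0_le_integral => //.
- by move=> u _; rewrite patchE; case: ifP.
- by apply/(measurable_restrictT _ (measurable_itv _)); exact: measurable_funTS.
- apply/(measurable_restrictT _ (measurable_itv _)); apply/measurable_EFinP.
  exact: measurable_funTS.
move=> u _; rewrite !patchE /g indicE !mem_setE !in_itv/= /pmin le_max le_min.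
have [u0|u0]//= := leP 0 u.
case: (u <= y) => /=; last by case: ifP => // _; rewrite lee_fin.
case: (u <= x) => /=; first by rewrite mulr1 orbT.
by rewrite mulr0; case: ifP => // _; rewrite lee_fin.
Qed.

Lemma ge0_integral_real d (T : measurableType d) (N : {measure set T -> \bar R})
    (g : T -> R) (c : R) : measurable_fun setT g -> (forall z, 0 <= g z) ->
  (\int[N]_z (g z)%:E <= c%:E)%E ->
  N.-integrable setT (EFin \o g) /\ exists x : R, (\int[N]_z (g z)%:E = x%:E)%E.
Proof.
move=> mg g0 gc.
have gE : (\int[N]_z `|(EFin \o g) z| = \int[N]_z (g z)%:E)%E.
  by apply: eq_integral => z _ /=; rewrite ger0_norm.
have goo : (\int[N]_z (g z)%:E < +oo)%E by rewrite (le_lt_trans gc)// ltry.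
split; first by apply/integrableP; split; [exact/measurable_EFinP|rewrite gE].
exists (fine (\int[N]_z (g z)%:E)); rewrite fineK// ge0_fin_numE//.
by apply: integral_ge0 => z _; rewrite lee_fin.
Qed.

(** [H] is the bound on [s] given by [payment_le_sum], with the diagonal payoff subtracted. Its five
    pieces are nonnegative with finite integrals, so its integral splits into real numbers. *)
Lemma payment_bound mu nu r1 r2 q1 q2 s :
  regular_law mu -> regular_law nu -> revenue_le mu r1 -> revenue_le nu r2 ->
  mech2 q1 q2 s ->
  exists H : R * R -> R,
    [/\ measurable_fun setT H,
        (forall x y, 0 <= x -> 0 <= y -> s (x, y) <= H (x, y)) &
        (\int[mu \x nu]_z (H z)%:E <= ((r1 + r2) * (1 + (expR 1)^-1))%:E)%E].
Proof.
move=> regmu regnu H1 H2 M; have M' := mech2_swapped M.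
have r10 := revenue_le_ge0 H1; have r20 := revenue_le_ge0 H2.
have [[mq1 mq2 ms] q01 ir _] := M.
pose Q1 := diag q1; pose Q2 := diag q2; pose beta := diag_payoff q1 q2 s.
have mQ1 : measurable_fun setT Q1 by exact: measurable_diag.
have mQ2 : measurable_fun setT Q2 by exact: measurable_diag.
have mbeta : measurable_fun setT beta.
  apply: measurable_funB; last exact: measurable_diag.
  by apply: measurable_funM => //; exact: measurable_funD.
have Q101 y : 0 <= Q1 y <= 1 by have [] := q01 (y, y).
have Q201 y : 0 <= Q2 y <= 1 by have [] := q01 (y, y).
have Q10 y : 0 <= Q1 y by case/andP: (Q101 y).
have Q20 y : 0 <= Q2 y by case/andP: (Q201 y).
have beta0 t : 0 <= t -> 0 <= beta t.
  by move=> t0; have := ir (t, t) t0 t0; rewrite /beta /diag_payoff /diag/=; lra.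
have gfin1 := integral_mean_min_le H1 H2; have gfin2 := integral_mean_min_le H2 H1.
have mpm : measurable_fun setT (fun z : R * R => pmin z.1 z.2) := measurable_pmin.
pose U1 := extra_pay q2 s.
pose U2 := swapped (extra_pay (swapped q1) (swapped s)).
pose V1 z := pmin z.1 z.2 * Q1 z.2.
pose V2 := swapped (fun z => pmin z.1 z.2 * Q2 z.2).
pose W (z : R * R) := beta (pmin z.1 z.2).
have mV (Q : R -> R) : measurable_fun setT Q ->
    measurable_fun setT (fun z : R * R => pmin z.1 z.2 * Q z.2).
  move=> mQ; apply: measurable_funM => //.
  by apply: measurableT_comp => //; exact: measurable_snd.
have V0 (Q : R -> R) : (forall y, 0 <= Q y) -> forall z : R * R, 0 <= pmin z.1 z.2 * Q z.2.
  by move=> Q0 z; rewrite mulr_ge0// pmin_ge0.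
have mU1 : measurable_fun setT U1 by exact: measurable_extra_pay.
have mU2' : measurable_fun setT (extra_pay (swapped q1) (swapped s)).
  by apply: measurable_extra_pay; exact: measurable_swapped.
have mU2 : measurable_fun setT U2 by exact: measurable_swapped.
have mV1 : measurable_fun setT V1 by exact: mV.
have mV2 : measurable_fun setT V2 by apply: measurable_swapped; exact: mV.
have mW : measurable_fun setT W by apply: measurableT_comp.
have U10 z : 0 <= U1 z by exact: extra_pay_ge0 M.
have U20 z : 0 <= U2 z by exact: extra_pay_ge0 M'.
have V10 z : 0 <= V1 z by exact: V0.
have V20 z : 0 <= V2 z by exact: V0.
have W0 z : 0 <= W z by rewrite beta0// pmin_ge0.
have a_real mu' (Q : R -> R) : measurable_fun setT Q -> (forall y, 0 <= Q y <= 1) ->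
    exists a : R, (\int[mu']_y (Q y)%:E = a%:E)%E.
  move=> mQ Q01; apply: (@ge0_integral_real _ _ mu' Q 1 mQ _ _).2.
  - by move=> y; case/andP: (Q01 y).
  - apply: ge0_integral_le_cst; first exact/measurable_EFinP.
    + by move=> y; rewrite lee_fin; case/andP: (Q01 y).
    + by move=> y; rewrite lee_fin; case/andP: (Q01 y).
have [a1 a1E] := a_real nu Q1 mQ1 Q101.
have [a2 a2E] := a_real mu Q2 mQ2 Q201.
(* Here [nu] supplies the density and [mu] the truncated mean, hence [r2 / expR 1]; in [S2] the
   roles are exchanged. *)
have S1 : (\int[nu]_y (Q1 y * mean_min mu y)%:E <= r1%:E * a1%:E
    + (\int[lam]_(u in `[0%R, +oo[) (Q1 u * (tail mu u * tail nu u))%:E + (r2 / expR 1)%:E))%E.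
  under [X in (_ <= _ + (X + _))%E]eq_integral do rewrite (mulrC (tail mu _)).
  rewrite -a1E; apply: surplus_le => //.
  - by move=> u; exact: revenue_le_tail.
  - by move=> u; exact: revenue_le_tail.
  - by rewrite (le_lt_trans gfin2)// ltry.
have S2 : (\int[mu]_y (Q2 y * mean_min nu y)%:E <= r2%:E * a2%:E
    + (\int[lam]_(u in `[0%R, +oo[) (Q2 u * (tail mu u * tail nu u))%:E + (r1 / expR 1)%:E))%E.
  rewrite -a2E; apply: surplus_le => //.
  - by move=> u; exact: revenue_le_tail.
  - by move=> u; exact: revenue_le_tail.
  - by rewrite (le_lt_trans gfin1)// ltry.
have a10 : 0 <= a1 by rewrite -lee_fin -a1E integral_ge0// => y _; rewrite lee_fin.
have a20 : 0 <= a2 by rewrite -lee_fin -a2E integral_ge0// => y _; rewrite lee_fin.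
have Ub1 := integral_extra_pay_prod nu H1 M.
have Ub2 := integral_extra_pay_prod mu H2 M'.
have [iU1 [u1 u1E]] : (mu \x nu)%E.-integrable setT (EFin \o U1) /\
    exists x : R, (\int[mu \x nu]_z (U1 z)%:E = x%:E)%E.
  apply: (@ge0_integral_real _ _ _ _ r1) => //; apply: le_trans Ub1.
  by rewrite leeDl// a1E -EFinM lee_fin mulr_ge0.
have [iU2 [u2 u2E]] : (mu \x nu)%E.-integrable setT (EFin \o U2) /\
    exists x : R, (\int[mu \x nu]_z (U2 z)%:E = x%:E)%E.
  apply: (@ge0_integral_real _ _ _ _ r2) => //; apply: le_trans Ub2.
  rewrite integral_swapped//; last by move=> z; exact: extra_pay_ge0 M'.
  by rewrite leeDl// mule_ge0 ?lee_fin// integral_ge0// => y _; rewrite lee_fin.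
have V_real (Q : R -> R) mu' nu' : measurable_fun setT Q -> (forall y, 0 <= Q y <= 1) ->
    (\int[mu']_x (mean_min nu' x)%:E <= (r1 + r2)%:E)%E ->
    (\int[mu' \x nu']_z (pmin z.1 z.2 * Q z.2)%:E <= (r1 + r2)%:E)%E.
  move=> mQ Q01; apply: le_trans; rewrite -integral_pmin; apply: ge0_le_integral => //.
  - by move=> z _; rewrite lee_fin V0// => y; case/andP: (Q01 y).
  - by apply/measurable_EFinP; exact: mV.
  - exact/measurable_EFinP.
  - by move=> z _; rewrite lee_fin ler_piMr ?pmin_ge0//; case/andP: (Q01 z.2).
have [iV1 [v1 v1E]] : (mu \x nu)%E.-integrable setT (EFin \o V1) /\
    exists x : R, (\int[mu \x nu]_z (V1 z)%:E = x%:E)%E.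
  by apply: (@ge0_integral_real _ _ _ _ (r1 + r2)) => //; exact: V_real.
have [iV2 [v2 v2E]] : (mu \x nu)%E.-integrable setT (EFin \o V2) /\
    exists x : R, (\int[mu \x nu]_z (V2 z)%:E = x%:E)%E.
  apply: (@ge0_integral_real _ _ _ _ (r1 + r2)) => //.
  rewrite integral_swapped//; [|exact: mV|exact: V0].
  by apply: V_real => //; rewrite addrC.
have [iW [w wE]] : (mu \x nu)%E.-integrable setT (EFin \o W) /\
    exists x : R, (\int[mu \x nu]_z (W z)%:E = x%:E)%E.
  (* The subgradient at [t], of size at most 2, compared with the payoff at 0 gives
     [beta t <= beta 0 + 2 * t]. *)
  apply: (@ge0_integral_real _ _ _ _ (beta 0 + 2 * (r1 + r2))) => //.
  apply: (@le_trans _ _ (\int[mu \x nu]_z ((beta 0)%:E + 2%:E * (pmin z.1 z.2)%:E))%E).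
    apply: ge0_le_integral => //.
    - by move=> z _; rewrite lee_fin.
    - exact/measurable_EFinP.
    - apply: emeasurable_funD => //; apply: emeasurable_funM => //.
      exact/measurable_EFinP.
    - move=> z _; rewrite -EFinM -EFinD lee_fin.
      have := diag_payoff_subgradient M (pmin_ge0 z.1 z.2) (lexx 0).
      have := pmin_ge0 z.1 z.2; case/andP: (Q101 (pmin z.1 z.2)) => ? ?.
      case/andP: (Q201 (pmin z.1 z.2)) => ? ?.
      rewrite /W /beta -/Q1 -/Q2; nra.
  rewrite ge0_integralD//; last 3 first.
  - by move=> z _; rewrite lee_fin beta0.
  - by move=> z _; rewrite -EFinM lee_fin mulr_ge0// pmin_ge0.
  - by apply: emeasurable_funM => //; exact/measurable_EFinP.
  rewrite integral_cst// ge0_integralZl_EFin//; last 2 first.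
  - by move=> z _; rewrite lee_fin pmin_ge0.
  - exact/measurable_EFinP.
  rewrite integral_pmin [leRHS]EFinD leeD//.
    by rewrite [X in (_ * X)%E](_ : _ = 1%E) ?mule1//;
      exact: (@probability_setT _ _ _ (mu \x nu)%E).
  by rewrite EFinM lee_wpmul2l// lee_fin.
(* The lower bound on the mean diagonal payoff at the minimum, [Q1 + Q2] being a subgradient of
   [beta]. *)
have tails : (\int[lam]_(u in `[0%R, +oo[) ((Q1 u + Q2 u) * (tail mu u * tail nu u))%:E
    <= w%:E)%E.
  rewrite -wE; apply: integral_tails_le => //.
  - exact: measurable_funD.
  - by move=> u; rewrite addr_ge0.
  - move=> z z0; apply: (@le_trans _ _ (beta z - beta 0)%:E); last first.
      by rewrite lee_fin gerBl beta0.
    apply: integral_subgradient_le => //.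
    + exact: measurable_funD.
    + by move=> t; have := Q101 t; have := Q201 t; rewrite !le_eqVlt; lra.
    + by move=> t u; exact: diag_payoff_subgradient.
have TT0 (Q : R -> R) u : (forall y, 0 <= Q y) -> 0 <= Q u * (tail mu u * tail nu u).
  by move=> Q0; rewrite !mulr_ge0// tail_ge0.
have mTT (Q : R -> R) (A : set R) : measurable_fun setT Q ->
    measurable_fun A (fun u => (Q u * (tail mu u * tail nu u))%:E).
  move=> mQ; apply/measurable_EFinP; apply: measurable_funTS.
  by apply: measurable_funM => //; apply: measurable_funM; exact: measurable_tail.
have tailsD : (\int[lam]_(u in `[0%R, +oo[) ((Q1 u + Q2 u) * (tail mu u * tail nu u))%:E
    = \int[lam]_(u in `[0%R, +oo[) (Q1 u * (tail mu u * tail nu u))%:E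
    + \int[lam]_(u in `[0%R, +oo[) (Q2 u * (tail mu u * tail nu u))%:E)%E.
  rewrite -ge0_integralD//; [|by move=> u _; rewrite lee_fin TT0|exact: mTT|
    by move=> u _; rewrite lee_fin TT0|exact: mTT].
  by apply: eq_integral => u _; rewrite -EFinD mulrDl.
have B0 (Q : R -> R) : (forall y, 0 <= Q y) ->
    (0 <= \int[lam]_(u in `[0%R, +oo[) (Q u * (tail mu u * tail nu u))%:E)%E.
  by move=> Q0; apply: integral_ge0 => u _; rewrite lee_fin TT0.
move: tails; rewrite {}tailsD.
move: S1 S2 (B0 Q1 Q10) (B0 Q2 Q20).
set B1 := (X in (_ <= _ + (X + _))%E -> _); set B2 := (X in _ -> (_ <= _ + (X + _))%E -> _).
move=> S1 S2 B10 B20 tails.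
have [b1 b1E] : exists b1, B1 = b1%:E.
  exists (fine B1); rewrite fineK// ge0_fin_numE//.
  apply: (@le_lt_trans _ _ w%:E); last exact: ltry.
  by apply: le_trans tails; rewrite leeDl.
have [b2 b2E] : exists b2, B2 = b2%:E.
  exists (fine B2); rewrite fineK// ge0_fin_numE//.
  apply: (@le_lt_trans _ _ w%:E); last exact: ltry.
  by apply: le_trans tails; rewrite leeDr.
exists (fun z => (U1 z + U2 z + (V1 z + V2 z)) - W z).
have iU := integrableD measurableT iU1 iU2.
have iV := integrableD measurableT iV1 iV2.
have iUV := integrableD measurableT iU iV.
split.
- by apply: measurable_funB => //; do ?[apply: measurable_funD => //].
- move=> x y x0 y0; have := payment_le_sum M x0 y0.
  rewrite /U1 /U2 /V1 /V2 /W /swapped/= (pminC y x) /beta -/Q1 -/Q2.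
  by rewrite -lerBrDr.
rewrite (integralB_EFin measurableT iUV iW).
rewrite (integralD_EFin measurableT iU iV) (integralD_EFin measurableT iU1 iU2).
rewrite (integralD_EFin measurableT iV1 iV2) /=.
rewrite u1E u2E v1E v2E wE -!EFinD lee_fin.
have le1 : u1 + r1 * a1 <= r1 by rewrite -lee_fin EFinD EFinM -u1E -a1E.
have le2 : u2 + r2 * a2 <= r2.
  rewrite -lee_fin EFinD EFinM -u2E -a2E integral_swapped// => z.
  exact: extra_pay_ge0 M'.
have le3 : v1 <= r1 * a1 + (b1 + r2 / expR 1).
  by rewrite -lee_fin !EFinD [(r1 * a1)%:E]EFinM -b1E -v1E integral_pmin_mul.
have le4 : v2 <= r2 * a2 + (b2 + r1 / expR 1).
  rewrite -lee_fin !EFinD [(r2 * a2)%:E]EFinM -b2E -v2E integral_swapped//.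
  - by rewrite integral_pmin_mul.
  - exact: mV.
  - exact: V0.
have le5 : b1 + b2 <= w by rewrite -lee_fin EFinD -b1E -b2E.
(* In the sum of these bounds the terms [r1 * a1] and [r2 * a2] cancel, and [w] absorbs
   [b1 + b2]. *)
lra.
Qed.
End product_bound.

(** * From random variables to their laws *)

Section transfer.
Set Implicit Arguments. Unset Strict Implicit. Unset Printing Implicit Defensive.
Context {R : realType} {d : measure_display} {T : measurableType d}.
Variable P : probability T R.
Local Notation RV := {mfun T >-> measurableTypeR R}.
Implicit Types X Y : RV.

(** Positive and negative parts are compared separately, which covers infinite integrals. *)
Lemma ae_le_integral (f g : T -> \bar R) : measurable_fun setT f ->
  measurable_fun setT g -> {ae P, forall w, (f w <= g w)%E} ->
  (\int[P]_w f w <= \int[P]_w g w)%E.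
Proof.
move=> mf mg fg; rewrite [leLHS]integralE [leRHS]integralE; apply: leeB.
- apply: ae_ge0_le_integral => //; [exact: measurable_funepos..|].
  by apply: filterS fg => w fgw _; rewrite !funeposE ge_max !le_max fgw lexx orbT.
- apply: ae_ge0_le_integral => //; [exact: measurable_funeneg..|].
  by apply: filterS fg => w fgw _; rewrite !funenegE ge_max !le_max leeN2 fgw lexx orbT.
Qed.

(** By independence the law of the pair agrees with the product law on rectangles, hence
    everywhere. *)
Lemma integral_joint X Y (f : R * R -> \bar R) : indep2 P X Y ->
  measurable_fun setT f ->
  (\int[P]_w f (X w, Y w) = \int[distribution P X \x distribution P Y]_z f z)%E.
Proof.
move=> XY mf.
have mXY : measurable_fun setT (fun w => (X w, Y w)).
  by apply/measurable_fun_pairP; split; exact: measurable_funP.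
pose XYm : {mfun T >-> (measurableTypeR R * measurableTypeR R)%type} :=
  HB.pack (fun w => (X w, Y w)) (isMeasurableFun.Build _ _ _ _ _ mXY).
have prodE (A : set (measurableTypeR R * measurableTypeR R)) : measurable A ->
    (distribution P X \x distribution P Y)%E A = distribution P XYm A.
  by move=> mA; apply: product_measure_unique => // B C mB mC; exact: XY.
have ge0 g : measurable_fun setT g -> (forall z, 0 <= g z)%E ->
    (\int[P]_w g (X w, Y w) = \int[distribution P X \x distribution P Y]_z g z)%E.
  move=> mg g0; rewrite -[LHS](ge0_integral_distribution XYm mg g0).
  by apply: eq_measure_integral => A mA _; exact/esym/prodE.
rewrite [LHS]integralE [RHS]integralE.
have mf_pos := measurable_funepos mf; have mf_neg := measurable_funeneg mf.
congr (_ - _)%E.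
- by rewrite -(ge0 _ mf_pos (funepos_ge0 f)); apply: eq_integral => w _; rewrite !funeposE.
- by rewrite -(ge0 _ mf_neg (funeneg_ge0 f)); apply: eq_integral => w _; rewrite !funenegE.
Qed.

Lemma weakly_regular_law X : weakly_regular P X -> regular_law (distribution P X).
Proof.
move=> [_ [alpha [beta [f]]]]; set I := [set t | _] => -[[a0 _] PE cf f0 reg].
exists alpha, beta, f; split => // t u It Iu tu.
have tE v : tail (distribution P X) v = tailG P X v.
  rewrite /tail /tailG /distribution /pushforward; congr (fine (P _)).
  by apply/seteqP; split => w /=; rewrite in_itv/= andbT.
by rewrite !tE; exact: reg.
Qed.

Lemma weakly_regular_ge0 X : weakly_regular P X -> {ae P, forall w, 0 <= X w}.
Proof.
move=> [_ [alpha [beta [f]]]]; set I := [set t | _] => -[[a0 _] PE _ _ _].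
exists (X @^-1` `]-oo, 0[); split.
- by rewrite -[X in measurable X]setTI; exact: measurable_funP.
- rewrite PE//; rewrite (_ : _ `&` _ = set0) ?integral_set0// -subset0 => t [] /=.
  by rewrite in_itv/= => t0 [at_ _]; move: t0; rewrite ltNge (le_trans a0).
- by move=> w /= /negP; rewrite -ltNge in_itv.
Qed.

Lemma Rev1_ge0 (X : T -> R) : (0 <= Rev1 P X)%E.
Proof.
apply: ereal_sup_ubound; exists (cst 0); last exact: integral0.
exists (cst 0); split=> //=; try by move=> *; rewrite ?mul0r ?subrr ?lexx ?ler01.
Qed.

Lemma revenue_le_law X r : Rev1 P X = r%:E -> revenue_le (distribution P X) r.
Proof.
move=> XE q s M s0; have [_ ms _ _ _] := M.
rewrite ge0_integral_distribution//; last exact/measurable_EFinP.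
by rewrite -XE; apply: ereal_sup_ubound; exists s => //; exists q.
Qed.

Lemma Rev2_le X Y r1 r2 : indep2 P X Y -> weakly_regular P X -> weakly_regular P Y ->
  Rev1 P X = r1%:E -> Rev1 P Y = r2%:E ->
  (Rev2 P X Y <= ((r1 + r2) * (1 + (expR 1)^-1))%:E)%E.
Proof.
move=> XY wX wY X1 Y2; apply: ge_ereal_sup => _ [s [q1 [q2 M]] <-].
have [[_ _ ms] _ _ _] := M.
have [H [mH sH intH]] := payment_bound (weakly_regular_law wX) (weakly_regular_law wY)
  (revenue_le_law X1) (revenue_le_law Y2) M.
apply: le_trans intH.
have mHE : measurable_fun setT (fun z => (H z)%:E) by exact/measurable_EFinP.
rewrite -(integral_joint XY mHE).
have mXY : measurable_fun setT (fun w => (X w, Y w)).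
  by apply/measurable_fun_pairP; split; exact: measurable_funP.
(* [H] is known to dominate [s] on the quadrant only, where the valuation lies almost surely. *)
apply: ae_le_integral.
- by apply/measurable_EFinP; exact: measurableT_comp.
- by apply/measurable_EFinP; exact: measurableT_comp.
- apply: filterS2 (weakly_regular_ge0 wX) (weakly_regular_ge0 wY) => w x0 y0.
  by rewrite lee_fin sH.
Qed.
End transfer.

(* SRev/Rev >= e/(e+1), stated without division as e * Rev <= (e+1) * SRev. *)
Theorem theorem2 (R : realType) (d : measure_display) (T : measurableType d)
  (P : probability T R) (X1 X2 : T -> R) :
  indep2 P X1 X2 -> weakly_regular P X1 -> weakly_regular P X2 ->
  ((expR 1)%:E * Rev2 P X1 X2 <= (expR 1 + 1)%:E * SRev2 P X1 X2)%E.
Proof.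
move=> ind wr1 wr2.
have e0 : 0 < expR 1 :> R := expR_gt0 1.
have := Rev1_ge0 P X1; have := Rev1_ge0 P X2; rewrite /SRev2.
(* If a one-good revenue is infinite, so is the right side; nonnegativity excludes the value
   [-oo]. *)
case E1 : (Rev1 P X1) => [r1| |]//; last first.
  by move=> r2_ge0 _; rewrite addye ?gt0_muley ?leey// ?lte_fin ?addr_gt0// gt_eqF//
    (lt_le_trans _ r2_ge0) ?ltNy0.
case E2 : (Rev1 P X2) => [r2| |]//; last first.
  by move=> _ _; rewrite addey// gt0_muley ?leey// lte_fin addr_gt0.
move=> _ _; rewrite -EFinD -EFinM.
pose Y1 : {mfun T >-> measurableTypeR R} :=
  HB.pack X1 (isMeasurableFun.Build _ _ T (measurableTypeR R) X1 wr1.1).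
pose Y2 : {mfun T >-> measurableTypeR R} :=
  HB.pack X2 (isMeasurableFun.Build _ _ T (measurableTypeR R) X2 wr2.1).
have := @Rev2_le R d T P Y1 Y2 r1 r2 ind wr1 wr2 E1 E2.
move=> /(lee_wpmul2l (ltW _ : 0 <= (expR 1)%:E)%E) => /(_ e0) /le_trans; apply.
(* The two sides are equal, as [e * (1 + 1/e) = e + 1]. *)
rewrite -EFinM lee_fin le_eqVlt; apply/orP; left; apply/eqP.
by field; rewrite gt_eqF.
Qed.
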